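(* Let $\{(u^k,\lambda^k)\}$, $\{\mu_k\}$, $\{w^k\}$ be generated by the stochastic augmented Lagrangian algorithm described in the context, and suppose that Assumptions A and B of the context hold and that (i) the sequence $\{u^k\}$ is almost surely contained in a bounded set $\hat B_\infty\subset\mathcal U$ such that $\mathrm d(u,\tilde u)\le i(\mathcal U)$ for all $u,\tilde u\in\hat B_\infty$; (ii) $\|\nabla_u\mathcal L_A(u^{k+1},w^k;\mu_k)\|_{\mathcal G}\to0$ almost surely as $k\to\infty$. Let $E:=\{\omega\in\Omega:\{\mu_k(\omega)\}_k\text{ is bounded}\}$. Then, almost surely on $E$, the sequence $\{\lambda^k(\omega)\}$ is bounded and any limit point $(\hat u,\hat\lambda)$ of $\{(u^k(\omega),\lambda^k(\omega))\}_{k\in\mathbb N}$ is a KKT point. On the set $\Omega\setminus E$ (almost surely), if a limit point $\hat u$ of $\{u^k(\omega)\}$ is feasible, then it is an AKKT point.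
   Context: **Setting.** $(\mathcal U,\mathcal G)$ is a (possibly infinite-dimensional) Riemannian manifold with norm $\|\cdot\|_{\mathcal G}=\sqrt{\mathcal G(\cdot,\cdot)}$, exponential map $\exp$, and geodesic distance $\mathrm d(u,q)=\inf$ of lengths of piecewise smooth curves joining $u$ to $q$. The injectivity radius at $u$ is $i_u=\sup\{r>0:\exp_u|_{B_r(0_u)}\text{ is a diffeomorphism}\}$, with $B_r(0_u)\subset T_u\mathcal U$ the ball of radius $r$ about the zero vector $0_u$, and $i(\mathcal U)=\inf_u i_u$. The (Riemannian) gradient $\nabla f(u)\in T_u\mathcal U$ of $f:\mathcal U\to\mathbb R$ is defined by $(f_* )_uw=\mathcal G_u(\nabla f(u),w)$ for all $w\in T_u\mathcal U$, where $(f_* )_u$ is the pushforward. $(\Omega,\mathcal F,\mathbb P)$ is a complete probability space, $\xi:\Omega\to\Xi\subset\mathbb R^m$ a random vector, $J:\mathcal U\times\Xi\to\mathbb R$, $j(u)=\mathbb E[J(u,\xi)]$, $h=(h_1,\dots,h_n)^\top:\mathcal U\to\mathbb R^n$, and $\{1,\dots,n\}$ is the disjoint union of $\mathcal E$ and $\mathcal I$. The problem is to minimize $j(u)$ over $u\in\mathcal U$ subject to $h_i(u)=0$ ($i\in\mathcal E$), $h_i(u)\le0$ ($i\in\mathcal I$); $u$ is feasible if it satisfies these constraints. $\nabla_uJ(u,\xi)$ is the gradient of $J(\cdot,\xi)$ at $u$; it is called a stochastic gradient if it is $\mathbb P$-integrable, its defining relation holds for all $u$ almost surely, and $\mathbb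 E[\nabla_uJ(u,\xi)]=\nabla j(u)$. Write $\nabla h(u)^\top\lambda=\sum_i\lambda_i\nabla h_i(u)$. $K=\{y\in\mathbb R^n: y_i=0\ \forall i\in\mathcal E,\ y_i\le0\ \forall i\in\mathcal I\}$, $\pi_C$ is the Euclidean projection onto a closed convex set $C$, $\operatorname{dist}_K$ the Euclidean distance to $K$. For $\lambda\in\mathbb R^n$, $\mu>0$: $$L_A(u,\lambda,\xi;\mu)=J(u,\xi)+\tfrac\mu2\operatorname{dist}_K\big(h(u)+\tfrac\lambda\mu\big)^2-\tfrac{\|\lambda\|_2^2}{2\mu},\qquad \mathcal L_A(u,\lambda;\mu)=j(u)+\tfrac\mu2\operatorname{dist}_K\big(h(u)+\tfrac\lambda\mu\big)^2-\tfrac{\|\lambda\|_2^2}{2\mu}.$$ **Algorithm.** Input: $u^1\in\mathcal U$, $\gamma>1$, $\tau\in(0,1)$, a bounded set $B\subset\mathbb R^n$, $\mu_1>0$, $\lambda^1\in\mathbb R^n$. For $k=1,2,\dots$: choose $w^k\in B$, step size $t_k$, iteration limit $N_k$, batch size $m_k$. Set $z^{k,1}=u^k$ and draw $R_k$ uniformly from $\{1,\dots,N_k\}$. For $j=1,\dots,R_k$ take i.i.d. samples $\xi^{k,j,1},\dots,\xi^{k,j,m_k}$ of $\xi$ and set $$z^{k,j+1}=\exp_{z^{k,j}}\Big(-\tfrac{t_k}{m_k}\sum_{s=1}^{m_k}\nabla_uL_A(z^{k,j},w^k,\xi^{k,j,s};\mu_k)\Big).$$ Set $u^{k+1}=z^{k,R_k+1}$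 and $\lambda^{k+1}=\mu_k\big(h(u^{k+1})+\frac{w^k}{\mu_k}-\pi_K(h(u^{k+1})+\frac{w^k}{\mu_k})\big)$. With $H_{k+1}=\|h(u^{k+1})-\pi_K(h(u^{k+1})+\frac{w^k}{\mu_k})\|_2$, set $\mu_{k+1}=\mu_k$ if $k=1$ or $H_{k+1}\le\tau H_k$, and $\mu_{k+1}=\gamma\mu_k$ otherwise. Here $\omega$ denotes an outcome of the random process of all samples and random stopping indices. **KKT point.** $(\hat u,\hat\lambda)\in\mathcal U\times\mathbb R^n$ with $\nabla j(\hat u)+\sum_{i=1}^n\hat\lambda_i\nabla h_i(\hat u)=0_{\hat u}$; $h_i(\hat u)=0$ for $i\in\mathcal E$; $h_i(\hat u)\le0$, $\hat\lambda_i\ge0$, $\hat\lambda_ih_i(\hat u)=0$ for $i\in\mathcal I$. **AKKT point.** A feasible point $\hat u$ is an AKKT point if there exist sequences $\{u^k\}\subset\mathcal U$ with $\mathrm d(u^k,\hat u)\to0$ and $\{\lambda^k\}\subset\{y\in\mathbb R^n: y^\top c\ge0\ \forall c\in -K\}$ (i.e. $\lambda^k_i\ge0$ for $i\in\mathcal I$) such that, as $k\to\infty$, $$\|\nabla j(u^k)+\nabla h(u^k)^\top\lambda^k\|_{\mathcal G}\to0\quad\text{and}\quad \pi_{-K}(-h(u^k))^\top\lambda^k\to0 .$$ (Componentwise $\pi_{-K}(-h)_i=0$ for $i\in\mathcal E$ and $\max(0,-h_i)$ for $i\in\mathcal I$.) **Lipschitz notion.** A $\mathcal C^1$ function $g:\mathcal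 U\to\mathbb R$ is $L_g$-Lipschitz continuously differentiable if there is $L_g>0$ with $\|P_{1,0}\nabla g(\tilde u)-\nabla g(u)\|_{\mathcal G}\le L_g\,\mathrm d(u,\tilde u)$ for all $u,\tilde u$ with $\mathrm d(u,\tilde u)<i(\mathcal U)$, where $P_{1,0}:T_{\tilde u}\mathcal U\to T_u\mathcal U$ is parallel transport along the unique geodesic $c$ with $c(0)=u$, $c(1)=\tilde u$. **Assumption A.** (i) $\mathrm d$ is non-degenerate; (ii) $i(\mathcal U)>0$; (iii) for all $u\in\mathcal U$ and all $\tilde u\in\exp_u(B_{i_u}(0_u))$, the minimizing geodesic between $u$ and $\tilde u$ is completely contained in $\exp_u(B_{i_u}(0_u))$. **Assumption B.** (i) $j$ and $h_i$ are $L_j$- resp. $L_{h_i}$-Lipschitz continuously differentiable and the gradients $\nabla j,\nabla h_i$ exist for all $u\in\mathcal U$ ($i=1,\dots,n$). (ii) $J$ is continuously differentiable in its first argument for every $\xi\in\Xi$, the stochastic gradient $\nabla_uJ$ exists, and there is $M>0$ with $\mathbb E[\|\nabla_uJ(u,\xi)-\nabla j(u)\|_{\mathcal G}^2]\le M^2$ for all $u\in\mathcal U$. *)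

(* Defs.v *)
From HB Require Import structures.
From mathcomp Require Import all_boot all_order all_algebra.
From mathcomp Require Import all_classical all_reals all_analysis.
Set Implicit Arguments.
Unset Strict Implicit.
Unset Printing Implicit Defensive.
Import Order.TTheory GRing.Theory Num.Theory.
Import numFieldNormedType.Exports.
Local Open Scope classical_set_scope.
Local Open Scope ring_scope.

(** The model space of a manifold is an arbitrary Hausdorff locally convex
    space, so Hilbert, Banach and Frechet manifolds (and finite-dimensional
    ones) are all covered.  [derive] of MathComp-Analysis is restricted to
    normed modules; [dderiv] is the same limit in a [tvsType]. *)

Definition dquot (R : realType) (V W : tvsType R) (f : V -> W) (x v : V)
    (t : R) : W :=
  t^-1 *: (f (x + t *: v) - f x).

Definition has_dderiv (R : realType) (V W : tvsType R) (f : V -> W) (x v : V)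
    (l : W) : Prop :=
  dquot f x v t @[t --> (0 : R)^'] --> l.

Definition dderiv (R : realType) (V W : tvsType R) (f : V -> W) (x v : V) : W :=
  xget 0 [set l | has_dderiv f x v l].

(** [Cn n O f]: [f] is of class C^n on the open set [O] in the sense of
    Michal-Bastiani: [f] is continuous, has all directional derivatives, and
    [(x, v) |-> D_v f x] is of class C^(n-1) on [O `*` setT].  [smooth] agrees
    with Frechet C^infinity between Banach spaces. *)
Fixpoint Cn (R : realType) (n : nat) (V W : tvsType R) (O : set V)
    (f : V -> W) {struct n} : Prop :=
  (forall x, O x -> {for x, continuous f}) /\
  match n with
  | 0%N => True
  | n'.+1 =>
      (forall x, O x -> forall v, exists l, has_dderiv f x v l) /\
      @Cn R n' (V * V)%type W (O `*` setT) (fun p => dderiv f p.1 p.2)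
  end.

Definition smooth (R : realType) (V W : tvsType R) (O : set V) (f : V -> W)
    : Prop :=
  forall n, Cn n O f.

(** The tangent space at [u] is [E], a tangent vector being given by its
    coordinates in the preferred chart [chart_at u]; at [u], the coordinates [v]
    in a chart [a] become [dderiv (phi b \o psi a) (phi a u) v] in a chart [b].
    [met a x] is the matrix of the metric at [psi a x] in the chart [a].  The
    metric may be weak: positive definiteness is required, but not that it
    induces the topology of the tangent spaces. *)
Record riemannian (R : realType) (E : tvsType R) (U : topologicalType) :=
  Riemannian {
  atlas : Type;
  chart_at : U -> atlas;
  cdom : atlas -> set U;
  ccod : atlas -> set E;
  phi : atlas -> U -> E;
  psi : atlas -> E -> U;
  met : atlas -> E -> E -> E -> R;
  model_hausdorff : hausdorff_space E;
  carrier_hausdorff : hausdorff_space U;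
  chart_atP : forall u, cdom (chart_at u) u;
  cdom_open : forall a, open (cdom a);
  ccod_open : forall a, open (ccod a);
  phiP : forall a u, cdom a u -> ccod a (phi a u) /\ psi a (phi a u) = u;
  psiP : forall a x, ccod a x -> cdom a (psi a x) /\ phi a (psi a x) = x;
  phi_continuous : forall a u, cdom a u -> {for u, continuous (phi a)};
  psi_continuous : forall a x, ccod a x -> {for x, continuous (psi a)};
  transition_smooth : forall a b,
    smooth (ccod a `&` psi a @^-1` cdom b) (phi b \o psi a);
  met_linear : forall a x, ccod a x -> forall (k : R) (v w z : E),
    met a x (k *: v + w) z = k * met a x v z + met a x w z;
  met_sym : forall a x, ccod a x -> forall v w, met a x v w = met a x w v;
  met_pos : forall a x, ccod a x -> forall v, v != 0 -> 0 < met a x v v;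
  met_smooth : forall a,
    @smooth R (E * E * E)%type R^o (ccod a `*` setT `*` setT)
      (fun p => met a p.1.1 p.1.2 p.2);
  met_compat : forall a b u, cdom a u -> cdom b u -> forall v w,
    met b (phi b u) (dderiv (phi b \o psi a) (phi a u) v)
                    (dderiv (phi b \o psi a) (phi a u) w) =
    met a (phi a u) v w }.

Section Geometry.
Context (R : realType) (E : tvsType R) (U : topologicalType).
Variable M : riemannian E U.

Definition gmetric (u : U) (v w : E) : R :=
  met (chart_at M u) (phi (chart_at M u) u) v w.

Definition tnorm (u : U) (v : E) : R := Num.sqrt (gmetric u v v).

Definition is_gradient (f : U -> R) (u : U) (g : E) : Prop :=
  forall w : E,
    @has_dderiv R E R^o (f \o psi (chart_at M u)) (phi (chart_at M u) u) w
      (gmetric u g w).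

(** The gradient is unique when it exists (which is not automatic for a weak
    metric); [grad f u] is [0] by convention when it does not exist. *)
Definition grad (f : U -> R) (u : U) : E := xget 0 [set g | is_gradient f u g].

Definition C1_function (f : U -> R) : Prop :=
  forall a : atlas M, @Cn R 1 E R^o (ccod a) (f \o psi a).

Definition smooth_curve (I : set R) (c : R -> U) : Prop :=
  (forall t, I t -> {for t, continuous c}) /\
  forall a : atlas M, @smooth R R^o E (I `&` c @^-1` cdom a) (phi a \o c).

Definition lvelocity (a : atlas M) (c : R -> U) (t : R) : E :=
  @dderiv R R^o E (phi a \o c) t 1.

Definition velocity (c : R -> U) (t : R) : E :=
  lvelocity (chart_at M (c t)) c t.

Definition curve_length (c : R -> U) (a b : R) : \bar R :=
  (\int[lebesgue_measure]_(t in `[a, b]) (tnorm (c t) (velocity c t))%:E)%E.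

(** On each closed piece the curve is the restriction of a curve which is smooth
    on a larger open interval. *)
Definition piecewise_smooth (c : R -> U) (a b : R) : Prop :=
  exists (n : nat) (s : nat -> R), [/\ s 0%N = a, s n = b &
    forall i, (i < n)%N -> s i < s i.+1 /\
      exists (e : R) (g : R -> U), [/\ 0 < e,
        smooth_curve `]s i - e, s i.+1 + e[ g &
        forall t, s i <= t <= s i.+1 -> g t = c t]].

(** [+oo] when no curve joins [u] to [q]. *)
Definition gdist (u q : U) : \bar R :=
  ereal_inf [set l | exists (a b : R) (c : R -> U),
    [/\ piecewise_smooth c a b, c a = u, c b = q & l = curve_length c a b]].

(** Christoffel symbols of the first kind: by Koszul's formula,
    [christoffel a x v w z] is the value at [(Gamma_x (v, w), z)] of the metric,
    where [Gamma] gives the Levi-Civita connection in the chart [a]. *)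
Definition christoffel (a : atlas M) (x v w z : E) : R :=
  2^-1 * (@dderiv R E R^o (fun y => met a y w z) x v
        + @dderiv R E R^o (fun y => met a y v z) x w
        - @dderiv R E R^o (fun y => met a y v w) x z).

(** For a vector field [X] along [c], i.e. [X t] tangent at [c t], its
    coordinates in the chart [a]. *)
Definition lfield (a : atlas M) (c : R -> U) (X : R -> E) (t : R) : E :=
  let b := chart_at M (c t) in dderiv (phi a \o psi b) (phi b (c t)) (X t).

(** [X' + Gamma_c (c', X) = 0] in every chart, tested against all [z]. *)
Definition parallel (I : set R) (c : R -> U) (X : R -> E) : Prop :=
  forall a : atlas M,
    @smooth R R^o E (I `&` c @^-1` cdom a) (lfield a c X) /\
    forall t, I t -> cdom a (c t) -> forall z : E,
      met a (phi a (c t)) (@dderiv R R^o E (lfield a c X) t 1) z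
      + christoffel a (phi a (c t)) (lvelocity a c t) (lfield a c X t) z = 0.

(** Defined on an open interval containing [0, 1]. *)
Definition geodesic01 (c : R -> U) : Prop :=
  exists e : R, [/\ 0 < e, smooth_curve `]- e, 1 + e[ c &
    parallel `]- e, 1 + e[ c (velocity c)].

(** [is_exp u v q]: [exp_u] is defined at [v] and [exp_u v = q].  The second
    clause is automatic when the geodesic equation has unique solutions. *)
Definition is_exp (u : U) (v : E) (q : U) : Prop :=
  (exists c, [/\ geodesic01 c, c 0 = u, velocity c 0 = v & c 1 = q]) /\
  (forall c, geodesic01 c -> c 0 = u -> velocity c 0 = v -> c 1 = q).

(** Used only where [exp_u] is defined. *)
Definition rexp (u : U) (v : E) : U := xget u [set q | is_exp u v q].

Definition tball (u : U) (r : \bar R) : set E :=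
  [set v | ((tnorm u v)%:E < r)%E].

(** The existence of [log] gives injectivity on the ball; the image is open and
    both directions are smooth in charts. *)
Definition exp_diffeo (u : U) (r : R) : Prop :=
  let B := tball u r%:E in
  let V := rexp u @` B in
  [/\ forall v, B v -> exists q, is_exp u v q,
      open V,
      forall v, B v -> {for v, continuous (rexp u)},
      forall a : atlas M, smooth (B `&` rexp u @^-1` cdom a) (phi a \o rexp u) &
      exists log : U -> E, (forall v, B v -> log (rexp u v) = v) /\
        forall a : atlas M, smooth (ccod a `&` psi a @^-1` V) (log \o psi a)].

Definition inj_radius_at (u : U) : \bar R :=
  ereal_sup [set r%:E | r in [set r : R | 0 < r /\ exp_diffeo u r]].

Definition inj_radius : \bar R := ereal_inf (range inj_radius_at).

Definition normal_ball (u : U) : set U :=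
  [set q | exists2 v, tball u (inj_radius_at u) v & is_exp u v q].

Definition min_geodesic (u q : U) (c : R -> U) : Prop :=
  [/\ geodesic01 c, c 0 = u, c 1 = q & curve_length c 0 1 = gdist u q].

(** [parallel_back c w v]: [v = P_(1,0) w] along [c]. *)
Definition parallel_back (c : R -> U) (w v : E) : Prop :=
  exists (e : R) (X : R -> E),
    [/\ 0 < e, parallel `]- e, 1 + e[ c X, X 1 = w & X 0 = v].

(** "The unique geodesic" from [u] to [q] is the unique minimizing one; its
    existence and that of the parallel transport are part of the notion. *)
Definition lipschitz_C1 (f : U -> R) : Prop :=
  C1_function f /\
  exists2 L : R, 0 < L & forall u q, (gdist u q < inj_radius)%E ->
    exists c : R -> U, [/\ min_geodesic u q c,
      forall c', min_geodesic u q c' -> forall t, 0 <= t <= 1 -> c' t = c t &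
      exists2 v, parallel_back c (grad f q) v &
        ((tnorm u (v - grad f u))%:E <= L%:E * gdist u q)%E].

Definition gbounded (A : set U) : Prop :=
  exists (u0 : U) (r : R), forall u, A u -> (gdist u0 u <= r%:E)%E.

Definition geometric_assumption : Prop :=
  [/\ forall u q, gdist u q = 0%E -> u = q,
      (0 < inj_radius)%E &
      forall u q, normal_ball u q -> forall c, min_geodesic u q c ->
        forall t, 0 <= t <= 1 -> normal_ball u (c t)].

End Geometry.

Section Euclidean.
Context (R : realType) (n : nat).
Implicit Types (y : 'rV[R]_n) (C : set 'rV[R]_n).

Definition dot y y' : R := \sum_i y 0 i * y' 0 i.

(** The norm of ['rV_n] in MathComp-Analysis is the sup norm. *)
Definition enorm y : R := Num.sqrt (dot y y).

Definition edist C y : R := inf [set enorm (y - z) | z in C].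

(** The Euclidean projection, for [C] nonempty, closed and convex. *)
Definition eproj C y : 'rV[R]_n :=
  xget 0 [set z | C z /\ forall z', C z' -> enorm (y - z) <= enorm (y - z')].

Definition ebounded C : Prop := exists r : R, forall y, C y -> enorm y <= r.

(** Equality constraints are indexed by [Eq], inequality constraints by its
    complement. *)
Definition coneK (Eq : {set 'I_n}) : set 'rV[R]_n :=
  [set y | (forall i, i \in Eq -> y 0 i = 0) /\
           (forall i, i \notin Eq -> y 0 i <= 0)].

Definition dual_cone C : set 'rV[R]_n :=
  [set y | forall c, C c -> 0 <= dot y c].

End Euclidean.

Section Problem.
Context (R : realType) (E : tvsType R) (U : topologicalType).
Variable M : riemannian E U.
Context (n : nat) (j : U -> R) (h : U -> 'rV[R]_n) (Eq : {set 'I_n}).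

Definition constr (i : 'I_n) (u : U) : R := h u 0 i.

Definition feasible (u : U) : Prop :=
  (forall i, i \in Eq -> h u 0 i = 0) /\ (forall i, i \notin Eq -> h u 0 i <= 0).

Definition lagr_grad (u : U) (lam : 'rV[R]_n) : E :=
  grad M j u + \sum_i lam 0 i *: grad M (constr i) u.

Definition KKT_point (u : U) (lam : 'rV[R]_n) : Prop :=
  [/\ lagr_grad u lam = 0,
      forall i, i \in Eq -> h u 0 i = 0 &
      forall i, i \notin Eq ->
        [/\ h u 0 i <= 0, 0 <= lam 0 i & lam 0 i * h u 0 i = 0]].

Definition AKKT_point (u : U) : Prop :=
  feasible u /\
  exists (us : nat -> U) (lams : nat -> 'rV[R]_n),
    let mK := [set - y | y in @coneK R n Eq] in
    [/\ gdist M (us k) u @[k --> \oo] --> 0%E,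
        forall k, dual_cone mK (lams k),
        tnorm M (us k) (lagr_grad (us k) (lams k)) @[k --> \oo] --> (0 : R) &
        dot (eproj mK (- h (us k))) (lams k) @[k --> \oo] --> (0 : R)].

(** [L_A(u, lam, xi; mu)] for [f := J(., xi)], and [L_A(u, lam; mu)] for
    [f := j]. *)
Definition aug_lagr (f : U -> R) (lam : 'rV[R]_n) (mu : R) (u : U) : R :=
  f u + mu / 2 * edist (@coneK R n Eq) (h u + mu^-1 *: lam) ^+ 2
  - enorm lam ^+ 2 / (2 * mu).

End Problem.

Definition gdist_limit_point (R : realType) (E : tvsType R) (U : topologicalType)
    (M : riemannian E U) (us : nat -> U) (u : U) : Prop :=
  exists s : nat -> nat, {homo s : i i' / (i < i')%N} /\
    gdist M (us (s i)) u @[i --> \oo] --> 0%E.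

Definition gdist_limit_point2 (R : realType) (E : tvsType R)
    (U : topologicalType) (M : riemannian E U) (n : nat) (us : nat -> U)
    (lams : nat -> 'rV[R]_n) (u : U) (lam : 'rV[R]_n) : Prop :=
  exists s : nat -> nat, [/\ {homo s : i i' / (i < i')%N},
    gdist M (us (s i)) u @[i --> \oo] --> 0%E &
    enorm (lams (s i) - lam) @[i --> \oo] --> (0 : R)].

(** The random vector [xi] takes values in [m.-tuple (measurableTypeR R)], i.e.
    R^m with its Borel sigma-algebra. *)
Notation rvec R m := (m.-tuple (measurableTypeR R)).

(** [f] is Bochner integrable with mean [y], with respect to the norm [N]: it is
    the L^1 limit of simple functions whose means converge to [y]. *)
Definition bochner_mean (R : realType) d (T : measurableType d)
    (P : probability T R) (E : lmodType R) (N : E -> R) (f : T -> E) (y : E)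
    : Prop :=
  exists (k : nat -> nat) (A : nat -> nat -> set T) (v : nat -> nat -> E),
    let s n w := \sum_(i < k n) \1_(A n i) w *: v n i in
    [/\ forall n i, measurable (A n i),
        forall n, measurable_fun setT (fun w => N (f w - s n w)),
        (\int[P]_w (N (f w - s n w))%:E)%E @[n --> \oo] --> 0%E &
        N (\sum_(i < k n) fine (P (A n i)) *: v n i - y) @[n --> \oo]
          --> (0 : R)].

Section Stochastic.
Context (R : realType) (E : tvsType R) (U : topologicalType).
Variable M : riemannian E U.
Context (d : measure_display) (Om : measurableType d) (P : probability Om R).
Context (m : nat) (J : U -> rvec R m -> R) (xi : Om -> rvec R m).

Definition exp_cost (u : U) : R := fine 'E_P[fun w => J u (xi w)].

Definition stochastic_gradient : Prop :=
  forall u,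
    {ae P, forall w,
      is_gradient M (J ^~ (xi w)) u (grad M (J ^~ (xi w)) u)} /\
    bochner_mean P (tnorm M u) (fun w => grad M (J ^~ (xi w)) u)
      (grad M exp_cost u).

Definition regularity_assumption (Xi : set (rvec R m)) (n : nat)
    (h : U -> 'rV[R]_n) : Prop :=
  [/\ lipschitz_C1 M exp_cost /\
        (forall u, exists g, is_gradient M exp_cost u g),
      forall i, lipschitz_C1 M (constr h i) /\
        (forall u, exists g, is_gradient M (constr h i) u g),
      forall x, Xi x -> C1_function M (J ^~ x),
      stochastic_gradient &
      exists2 B : R, 0 < B & forall u,
        (\int[P]_w ((tnorm M u
           (grad M (J ^~ (xi w)) u - grad M exp_cost u)) ^+ 2)%:E
         <= (B ^+ 2)%:E)%E].

(** All sequences of the algorithm are indexed from 1, as in the pseudocode; their values at 0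
    are irrelevant. *)

(** [xs k l s] is the sample xi^(k,l,s), [Rk k] the stopping index, [F k] the
    information available when iteration [k] starts.  The iteration limit [N k]
    and batch size [mb k] may depend on the past, so the law of the draws is
    given conditionally on [F k]: for any event of [F k] and any value [c] of
    [N k], the index [Rk k] is uniform on [1, c] and the samples of
    iteration [k] are distributed as [xi], all of them being independent of one
    another and of [F k]. *)
Definition sampling (Xi : set (rvec R m)) (F : nat -> set (set Om))
    (N mb Rk : nat -> Om -> nat) (xs : nat -> nat -> nat -> Om -> rvec R m)
    : Prop :=
  [/\ forall k, [/\ sigma_algebra setT (F k), F k `<=` measurable &
        F k `<=` F k.+1],
      forall k c, (0 < k)%N ->
        F k (N k @^-1` [set c]) /\ F k (mb k @^-1` [set c]),
      forall k, (0 < k)%N ->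
        (forall r, F k.+1 (Rk k @^-1` [set r])) /\
        (forall l s C, measurable C -> F k.+1 (xs k l s @^-1` C)),
      forall k l s w, Xi (xs k l s w) &
      forall k A c r (ls : seq (nat * nat)) (C : nat * nat -> set (rvec R m)),
        (0 < k)%N -> F k A -> (0 < r <= c)%N -> uniq ls ->
        (forall p, measurable (C p)) ->
        P (A `&` N k @^-1` [set c] `&` Rk k @^-1` [set r] `&`
           \bigcap_(p in [set` ls]) (xs k p.1 p.2 @^-1` C p)) =
        (P (A `&` N k @^-1` [set c]) * (c%:R^-1)%:E *
         (\prod_(p <- ls) fine (P (xi @^-1` C p)))%:E)%E].

(** One run of the algorithm, for a fixed outcome: [ws], [ts], [Ns], [ms] are
    the choices of w^k, t_k, N_k, m_k and [us], [lams], [mus], [zs] the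
    iterates. *)
Definition run (n : nat) (h : U -> 'rV[R]_n) (Eq : {set 'I_n})
    (gam tau : R) (B : set 'rV[R]_n) (u1 : U) (mu1 : R) (lam1 : 'rV[R]_n)
    (ws : nat -> 'rV[R]_n) (ts : nat -> R) (Ns ms : nat -> nat)
    (Rs : nat -> nat) (x : nat -> nat -> nat -> rvec R m)
    (us : nat -> U) (lams : nat -> 'rV[R]_n) (mus : nat -> R)
    (zs : nat -> nat -> U) : Prop :=
  let K := @coneK R n Eq in
  let shifted k := h (us k.+1) + (mus k)^-1 *: ws k in
  let H k := enorm (h (us k) - eproj K (shifted k.-1)) in
  [/\ us 1%N = u1, mus 1%N = mu1, lams 1%N = lam1 &
    forall k, (0 < k)%N ->
      [/\ [/\ B (ws k), 0 < ts k, (0 < Ns k)%N, (0 < ms k)%N &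
              (0 < Rs k <= Ns k)%N],
          zs k 1%N = us k /\
            (forall l, (0 < l <= Rs k)%N ->
              is_exp M (zs k l)
                (- ((ts k / (ms k)%:R) *: \sum_(1 <= s < (ms k).+1)
                   grad M (aug_lagr h Eq (J ^~ (x k l s)) (ws k) (mus k))
                     (zs k l)))
                (zs k l.+1)),
          us k.+1 = zs k (Rs k).+1,
          lams k.+1 = mus k *: (shifted k - eproj K (shifted k)) &
          mus k.+1 = if (k == 1%N) || (H k.+1 <= tau * H k) then mus k
                     else gam * mus k]].

End Stochastic.

(* Main.v *)
Require Import Defs.
From HB Require Import structures.
From mathcomp Require Import all_boot all_order all_algebra.
From mathcomp Require Import all_classical all_reals all_analysis.
From mathcomp Require Import ring lra.
Import Order.TTheory GRing.Theory Num.Theory.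
Import numFieldNormedType.Exports.
Local Open Scope classical_set_scope.
Local Open Scope ring_scope.

(** The argument is pathwise: both conclusions hold along every single run of
    the algorithm for which the gradients of the augmented Lagrangian tend to
    [0], hence almost surely.

    The gradient of [dist_K ^ 2 / 2] is [id - pi_K], so by the multiplier update
    the gradient of the augmented Lagrangian at [u^(k+1)] with multiplier [w^k]
    is the gradient of the Lagrangian at [(u^(k+1), lambda^(k+1))]
    ([grad_aug_lagr]). Approximate stationarity of the iterates is thus what the
    hypothesis on the gradients says, and two regimes of the penalty remain.

    If the penalty stays bounded it is eventually constant, so the violation
    [H_k] contracts geometrically ([viol_cvg0]). As
    [lambda^(k+1) = mu_k (h - pi_K) + w^k], the multipliers are bounded, and
    feasibility, signs and complementarity pass to the limit
    ([constr_ineq_le_viol], [complementarity_le_viol]). If it is unbounded, it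
    tends to infinity, and the complementarity terms are at most
    [b ^ 2 / mu_k], where [b] bounds the [w^k] ([complementarity_le_mu]).

    In the bounded case stationarity and the constraints have to be carried from
    the iterates to the limit point, although gradients at different points lie
    in different tangent spaces and the metric may be weak. Parallel transport
    is isometric ([parallel_isometry]): in a chart, the derivative of the metric
    along the curve is compensated by the Christoffel terms of the two fields.
    Hence the gradients of the objective and of all constraints at the limit
    point are transported simultaneously to the iterate with their Gram matrix
    unchanged, and there differ from the gradients at the iterate by at most the
    Lipschitz constants times the distance ([lagr_grad_transport]). Applied to
    velocities, isometry says that geodesics have constant speed, so that
    integrating a gradient along a minimizing geodesic shows the continuity of
    the constraints with respect to the geodesic distance
    ([lipschitz_increment]). *)

(** * Directional derivatives in topological vector spaces *)

Section Calculus.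
Context {R : realType}.
Implicit Types V W : tvsType R.

Lemma cvgD_tvs {V} {T : Type} {F : set_system T} {FF : Filter F}
    (f g : T -> V) (a b : V) :
  f @ F --> a -> g @ F --> b -> (fun x => f x + g x) @ F --> a + b.
Proof.
move=> fa gb.
apply: (@continuous2_cvg T V V V F FF f g (fun x y => x + y)) => //.
exact: (@add_continuous V (a, b)).
Qed.

Lemma cvgZ_tvs {V} {T : Type} {F : set_system T} {FF : Filter F}
    (k : T -> R) (f : T -> V) (c : R) (a : V) :
  k @ F --> c -> f @ F --> a -> (fun x => k x *: f x) @ F --> c *: a.
Proof.
move=> kc fa.
apply: (@continuous2_cvg T R^o V V F FF k f (fun x y => x *: y)) => //.
exact: (@scale_continuous R V (c, a)).
Qed.

(** Restricting to a line turns a directional derivative of a real-valued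
    function into an ordinary one, to which the one-variable differential
    calculus applies. *)
Lemma has_dderiv_line {V} (f : V -> R) (x v : V) (r l : R) :
  @has_dderiv R V R^o f (x + r *: v) v l <->
  is_derive r 1 (fun s : R => f (x + s *: v)) l.
Proof.
rewrite /has_dderiv.
have -> : @dquot R V R^o f (x + r *: v) v =
    (fun h : R => h^-1 *: (((fun s : R => f (x + s *: v)) \o shift r) (h *: 1)
               - f (x + r *: v))).
  apply/funext => h /=; rewrite /dquot /shift /=.
  by rewrite -addrA -scalerDl [h *: 1]mulr1 (addrC r).
split=> [H|[H <-]]; last exact: H.
by apply: DeriveDef; [exact: cvgP H|exact: cvg_lim H].
Qed.

Lemma has_dderiv_real (f : R -> R) (t l : R) :
  @has_dderiv R R^o R^o f t 1 l <-> is_derive t 1 f l.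
Proof.
have := @has_dderiv_line R^o f 0 1 t l.
rewrite add0r [t *: 1]mulr1.
suff -> : (fun s : R => f (0 + s *: 1)) = f by [].
by apply/funext => s; rewrite add0r [s *: 1]mulr1.
Qed.

Lemma dderivP {V W} (f : V -> W) x v :
  (exists l, has_dderiv f x v l) -> has_dderiv f x v (dderiv f x v).
Proof. exact: xgetPex. Qed.

Lemma has_dderiv_unique {V W} (f : V -> W) x v l l' : hausdorff_space W ->
  has_dderiv f x v l -> has_dderiv f x v l' -> l = l'.
Proof. by move=> hW; apply: cvg_unique. Qed.

Lemma dderivE {V W} (f : V -> W) x v l : hausdorff_space W ->
  has_dderiv f x v l -> dderiv f x v = l.
Proof.
move=> hW H; apply: (has_dderiv_unique f x v) => //.
by apply: dderivP; exists l.
Qed.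

Lemma line_cvg {V} (x v : V) :
  (x + t *: v) @[t --> (0 : R)^'] --> x.
Proof.
rewrite -[X in _ --> X]addr0 -(scale0r v).
apply: cvgD_tvs; first exact: cvg_cst.
apply: cvgZ_tvs; last exact: cvg_cst.
exact: (@nbhs_dnbhs R^o).
Qed.

Lemma near_dquot {V W} (f g : V -> W) (x v : V) : (\near x, f x = g x) ->
  \forall t \near (0 : R)^', dquot f x v t = dquot g x v t.
Proof.
move=> fg; have fgx := nbhs_singleton fg.
have fgt : \forall t \near (0 : R)^', f (x + t *: v) = g (x + t *: v).
  exact: line_cvg x v _ fg.
by apply: filterS fgt => t fgt; rewrite /dquot fgx fgt.
Qed.

Lemma has_dderiv_near {V W} (f g : V -> W) (x v : V) l : (\near x, f x = g x) ->
  has_dderiv f x v l -> has_dderiv g x v l.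
Proof.
by move=> /(near_dquot _ _ _ v) fg; apply: cvg_trans; apply: near_eq_cvg.
Qed.

Lemma near_eq_sym {V W} (f g : V -> W) (x : V) : (\near x, f x = g x) ->
  \near x, g x = f x.
Proof. by apply: filterS => ? ->. Qed.

Lemma dderiv_near {V W} (f g : V -> W) (x v : V) : (\near x, f x = g x) ->
  dderiv f x v = dderiv g x v.
Proof.
move=> fg; congr (xget _ _); apply/seteqP; split => l /=.
  exact: has_dderiv_near.
exact/has_dderiv_near/near_eq_sym.
Qed.

Lemma has_dderiv_pair {V W W'} (f : V -> W) (g : V -> W') x v l l' :
  has_dderiv f x v l -> has_dderiv g x v l' ->
  @has_dderiv R V (W * W')%type (fun y => (f y, g y)) x v (l, l').
Proof. by move=> fl gl; apply: cvg_pair fl gl. Qed.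

(** The step [s] of a difference quotient may have either sign, and the
    condition [`|r| <= `|s|] covers both orientations of the segment. *)
Lemma mean_value {V} (O : set V) (f : V -> R) (x y : V) (s : R) :
  (forall p, O p -> forall v, exists l, @has_dderiv R V R^o f p v l) ->
  (forall r : R, `|r| <= `|s| -> O (x + r *: y)) ->
  exists2 r : R, `|r| <= `|s| &
    f (x + s *: y) - f x = s * @dderiv R V R^o f (x + r *: y) y.
Proof.
move=> df xO; set F : R -> R := fun r => f (x + r *: y).
set dF : R -> R := fun r => @dderiv R V R^o f (x + r *: y) y.
have dFP (r : R) : `|r| <= `|s| -> is_derive r 1 F (dF r).
  by move=> /xO /df /(_ y) /dderivP /has_dderiv_line.
have cF (r : R) : `|r| <= `|s| -> {for r, continuous F}.
  by move=> /dFP [+ _] => /derivable1_diffP/differentiable_continuous.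
have F0 : F 0 = f x by rewrite /F scale0r addr0.
have cFs (a b : R) : (forall r : R, r \in `[a, b] -> `|r| <= `|s|) ->
    {within `[a, b], continuous F}.
  by move=> ab; apply: continuous_in_subspaceT => r /set_mem /= /ab /cF.
have [s0|s0] := leP 0 s.
  have ab r : r \in `[0, s] -> `|r| <= `|s|.
    by rewrite in_itv /= => /andP[r0 rs]; rewrite !ger0_norm.
  have [r r0s||r rs E] := @MVT_segment R F dF 0 s s0.
  - by apply: dFP; apply: ab; apply: subset_itv_oo_cc r0s.
  - exact: cFs.
  - by exists r; [exact: ab|rewrite -F0 E subr0 mulrC].
have ab r : r \in `[s, 0] -> `|r| <= `|s|.
  rewrite in_itv /= => /andP[rs r0].
  by rewrite (ler0_norm r0) (ltr0_norm s0) lerN2.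
have [r r0s||r rs E] := @MVT_segment R F dF s 0 (ltW s0).
- by apply: dFP; apply: ab; apply: subset_itv_oo_cc r0s.
- exact: cFs.
exists r; first exact: ab.
by rewrite -F0 -opprB E sub0r mulrN opprK mulrC.
Qed.

(** For a real-valued function the mean value theorem writes the difference
    quotient of [f \o g] at step [s] as [D f (x + r y_s) y_s], where [y_s] is
    the difference quotient of [g] and [`|r| <= `|s|]; the joint continuity of
    the derivative gives the limit. By continuity of the vector space
    operations, the points [x + r y_s] with [`|r| <= `|s|] are eventually in
    any given neighbourhood of [x], in particular in [O]. *)
Lemma has_dderiv_comp_curve {V} (O : set V) (f : V -> R) (g : R -> V) (t : R)
    l :
  open O -> @Cn R 1 V R^o O f -> O (g t) -> @has_dderiv R R^o V g t 1 l ->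
  is_derive t 1 (f \o g) (@dderiv R V R^o f (g t) l).
Proof.
move=> oO [_ [df [cdf _]]] Ogt gl; apply/has_dderiv_real.
set x := g t in Ogt *.
move=> W nW.
have [[A B] /= [nA nB] AB] := cdf (x, l) (conj Ogt I) _ nW.
have nAO : nbhs x (A `&` O) by apply: filterI => //; apply: open_nbhs_nbhs.
have : (fun z : R^o * V => x + z.1 *: z.2) @ nbhs ((0 : R^o), l) --> x.
  rewrite -[X in _ --> X]addr0 -(scale0r l).
  apply: cvgD_tvs; first exact: cvg_cst.
  exact: (@scale_continuous R V (0, l)).
move=> /(_ _ nAO) [[D B'] /= [/nbhs_ballP[e /= e0 De] nB'] DB'].
have yBB' : \forall s \near (0 : R)^', (B `&` B') (@dquot R R^o V g t 1 s).
  exact: gl _ (filterI nB nB').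
suff : \forall s \near (0 : R)^', W (@dquot R R^o R^o (f \o g) t 1 s) by [].
near=> s; set y := @dquot R R^o V g t 1 s.
have [Bs B's] : (B `&` B') y by apply: (near yBB' s).
have s0 : s != 0 by near: s; exact: nbhs_dnbhs_neq.
have se : `|s| < e by near: s; apply: dnbhs0_lt.
have gE : g (t + s *: 1) = x + s *: y.
  by rewrite /y /dquot scalerA divff // scale1r addrCA subrr addr0.
have seg (r : R) : `|r| <= `|s| -> (A `&` O) (x + r *: y).
  move=> rs; apply: (DB' (r, y)); split => //=; apply: De.
  by rewrite /ball /= sub0r normrN (le_lt_trans rs).
have [r rs E] := mean_value O f x y s df (fun r rs => (seg r rs).2).
have -> : @dquot R R^o R^o (f \o g) t 1 s = @dderiv R V R^o f (x + r *: y) y.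
  by rewrite /dquot /= gE E [_ *: _]mulrA mulVf // mul1r.
by apply: (AB (x + r *: y, y)); split => //=; have [] := seg _ rs.
Unshelve. all: by end_near. Qed.

End Calculus.

(** * Inner products and the pointwise metric *)

Section InnerProduct.
Context {R : realType} {E : lmodType R} (B : E -> E -> R).
Hypothesis Blin : forall k v w z, B (k *: v + w) z = k * B v z + B w z.
Hypothesis Bsym : forall v w, B v w = B w v.
Hypothesis Bpos : forall v, v != 0 -> 0 < B v v.
Let N v := Num.sqrt (B v v).

Lemma ip0l z : B 0 z = 0.
Proof. by have := Blin 1 0 0 z; rewrite scale1r addr0; lra. Qed.

Lemma ipDl v w z : B (v + w) z = B v z + B w z.
Proof. by rewrite -[v]scale1r Blin mul1r scale1r. Qed.

Lemma ipZl k v z : B (k *: v) z = k * B v z.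
Proof. by rewrite -[k *: v]addr0 Blin ip0l addr0. Qed.

Lemma ip0r z : B z 0 = 0. Proof. by rewrite Bsym ip0l. Qed.

Lemma ipDr v w z : B z (v + w) = B z v + B z w.
Proof. by rewrite Bsym ipDl !(Bsym z). Qed.

Lemma ipZr k v z : B z (k *: v) = k * B z v.
Proof. by rewrite Bsym ipZl (Bsym z). Qed.

Lemma ip_suml (I : Type) (r : seq I) (F : I -> E) z :
  B (\sum_(i <- r) F i) z = \sum_(i <- r) B (F i) z.
Proof. by apply: (big_morph (B^~ z)) => [v w|]; rewrite ?ipDl ?ip0l. Qed.

Lemma ip_ge0 v : 0 <= B v v.
Proof. by have [->|/Bpos/ltW//] := eqVneq v 0; rewrite ip0l. Qed.

Lemma ipnorm_eq0 v : N v = 0 -> v = 0.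
Proof.
move=> /eqP; rewrite sqrtr_eq0 => Bv; apply/eqP/negPn/negP => /Bpos.
by rewrite ltNge Bv.
Qed.

Lemma ipnormZ k v : N (k *: v) = `|k| * N v.
Proof.
by rewrite /N ipZl ipZr mulrA -expr2 sqrtrM ?sqr_ge0 // sqrtr_sqr.
Qed.

Lemma ip_cauchy_schwarz v w : `|B v w| <= N v * N w.
Proof.
rewrite -sqrtrM ?ip_ge0 // -sqrtr_sqr ler_wsqrtr //.
have [->|/Bpos w0] := eqVneq w 0; first by rewrite ip0r expr0n mulr_ge0 ?ip_ge0.
have := ip_ge0 (B w w *: v + (- B v w) *: w).
rewrite !(ipDl, ipDr, ipZl, ipZr) (Bsym w v) => H.
have {H} : 0 <= B w w * (B v v * B w w - B v w ^+ 2) by move: H; lra.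
by rewrite pmulr_rge0 // subr_ge0.
Qed.

Lemma ipnormD v w : N (v + w) <= N v + N w.
Proof.
rewrite -(ler_pXn2r (n := 2)) ?nnegrE ?addr_ge0 ?sqrtr_ge0 //.
rewrite sqr_sqrtr ?ip_ge0 // sqrrD !sqr_sqrtr ?ip_ge0 //.
rewrite !(ipDl, ipDr) (Bsym w v).
have := le_trans (ler_norm _) (ip_cauchy_schwarz v w); rewrite /N; lra.
Qed.

Lemma ipnorm_sum (I : Type) (r : seq I) (F : I -> E) :
  N (\sum_(i <- r) F i) <= \sum_(i <- r) N (F i).
Proof.
apply: (big_ind2 (fun v x => N v <= x)) => //; last first.
  by move=> v x w y vx wy; apply: le_trans (ipnormD _ _) (lerD vx wy).
by rewrite /N ip0l sqrtr0.
Qed.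

End InnerProduct.

Section RiemannianMetric.
Local Set Implicit Arguments.
Local Unset Strict Implicit.
Context {R : realType} {E : tvsType R} {U : topologicalType}.
Variable M : riemannian E U.

Lemma chart_in (u : U) : ccod (chart_at M u) (phi (chart_at M u) u).
Proof. by have [] := phiP (chart_atP M u). Qed.

Lemma gmetric_linear u k v w z :
  gmetric M u (k *: v + w) z = k * gmetric M u v z + gmetric M u w z.
Proof. exact/met_linear/chart_in. Qed.

Lemma gmetric_sym u v w : gmetric M u v w = gmetric M u w v.
Proof. exact/met_sym/chart_in. Qed.

Lemma gmetric_pos u v : v != 0 -> 0 < gmetric M u v v.
Proof. exact/met_pos/chart_in. Qed.

Lemma tnorm_ge0 u v : 0 <= tnorm M u v. Proof. exact: sqrtr_ge0. Qed.

Lemma tnorm_eq0 u v : tnorm M u v = 0 -> v = 0.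
Proof. exact: (ipnorm_eq0 _ (gmetric_pos u)). Qed.

Lemma tnormD u v w : tnorm M u (v + w) <= tnorm M u v + tnorm M u w.
Proof.
exact: (ipnormD _ (gmetric_linear u) (gmetric_sym u) (gmetric_pos u)).
Qed.

Lemma tnormZ u k v : tnorm M u (k *: v) = `|k| * tnorm M u v.
Proof. exact: (ipnormZ _ (gmetric_linear u) (gmetric_sym u)). Qed.

Lemma tnorm_sum u (I : Type) (r : seq I) (F : I -> E) :
  tnorm M u (\sum_(i <- r) F i) <= \sum_(i <- r) tnorm M u (F i).
Proof.
exact: (ipnorm_sum _ (gmetric_linear u) (gmetric_sym u) (gmetric_pos u)).
Qed.

Lemma gmetric_cauchy_schwarz u v w :
  `|gmetric M u v w| <= tnorm M u v * tnorm M u w.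
Proof.
exact: (ip_cauchy_schwarz _ (gmetric_linear u) (gmetric_sym u) (gmetric_pos u)).
Qed.

(** Two gradients have the same pairing with their difference, which is
    therefore isotropic. *)
Lemma is_gradient_unique (f : U -> R) u g g' :
  is_gradient M f u g -> is_gradient M f u g' -> g = g'.
Proof.
move=> fg fg'; apply/eqP; rewrite -subr_eq0.
apply/negPn/negP => /(gmetric_pos u).
have hR : hausdorff_space R^o := @norm_hausdorff R R^o.
set d := g - g'; have := has_dderiv_unique _ _ _ _ _ hR (fg d) (fg' d).
rewrite (gmetric_sym _ g) (gmetric_sym _ g') => E0.
have -> : gmetric M u d d = gmetric M u g d - gmetric M u g' d.
  by rewrite {1}/d addrC -[- g']scaleN1r gmetric_linear; ring.
by rewrite (gmetric_sym _ g) (gmetric_sym _ g') E0 subrr ltxx.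
Qed.

Lemma gradE (f : U -> R) u g : is_gradient M f u g -> grad M f u = g.
Proof.
move=> fg; apply: (is_gradient_unique (f := f) (u := u)) => //.
by apply: (@xgetPex _ 0 [set g | is_gradient M f u g]); exists g.
Qed.

Lemma gradP (f : U -> R) u : (exists g, is_gradient M f u g) ->
  is_gradient M f u (grad M f u).
Proof. by move=> [g fg]; rewrite (gradE fg). Qed.

(** * The metric along a curve *)

Section Charts.
Variable a : atlas M.

Lemma metDl x v w z : ccod a x -> met a x (v + w) z = met a x v z + met a x w z.
Proof. by move=> ax; apply: (ipDl _ (met_linear ax)). Qed.

Lemma metZl x k v z : ccod a x -> met a x (k *: v) z = k * met a x v z.
Proof. by move=> ax; apply: (ipZl _ (met_linear ax)). Qed.

Lemma metDr x v w z : ccod a x -> met a x z (v + w) = met a x z v + met a x z w.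
Proof. by move=> ax; apply: (ipDr _ (met_linear ax) (met_sym ax)). Qed.

Lemma metZr x k v z : ccod a x -> met a x z (k *: v) = k * met a x z v.
Proof. by move=> ax; apply: (ipZr _ (met_linear ax) (met_sym ax)). Qed.

Let metf : E * E * E -> R := fun p => met a p.1.1 p.1.2 p.2.
Let dom : set (E * E * E) := ccod a `*` setT `*` setT.

Lemma dom_open : open dom.
Proof.
rewrite openE => -[[p v] w] [[/= ap _] _]; exists (ccod a `*` setT, setT) => //.
split=> /=; last exact: filterT.
exists (ccod a, setT) => //; split=> /=; last exact: filterT.
by apply: open_nbhs_nbhs; split => //; apply: ccod_open.
Qed.

Lemma met_cvg {T : Type} {F : set_system T} {FF : Filter F} (x Y Z : T -> E)
    (p v w : E) : ccod a p -> x @ F --> p -> Y @ F --> v -> Z @ F --> w ->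
  (fun s => met a (x s) (Y s) (Z s)) @ F --> met a p v w.
Proof.
move=> ap xp Yv Zw.
have [cf _] := met_smooth a 0%N.
apply: (@continuous_cvg T (E * E * E)%type R^o F FF
  (fun s => (x s, Y s, Z s)) metf (p, v, w)).
  exact: cf (p, v, w) (conj (conj ap I) I).
exact: cvg_pair (cvg_pair xp Yv) Zw.
Qed.

Lemma has_dderiv_met p v w e : ccod a p ->
  @has_dderiv R E R^o (fun y => met a y v w) p e
    (@dderiv R E R^o (fun y => met a y v w) p e).
Proof.
move=> ap; apply: dderivP.
have [_ [df _]] := met_smooth a 1%N.
have [l fl] := df (p, v, w) (conj (conj ap I) I) (e, 0, 0).
exists l; move: fl; rewrite /has_dderiv.
suff -> : @dquot R (E * E * E)%type R^o metf (p, v, w) (e, 0, 0) =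
    @dquot R E R^o (fun y => met a y v w) p e by [].
by apply/funext => s; rewrite /dquot /metf /= !scaler0 !addr0.
Qed.

(** The Leibniz rule. Expanding [met a (p + s e) (v + s l) (w + s m)] by
    bilinearity leaves, besides the first-order terms, a quadratic remainder
    carrying a factor [s]. *)
Lemma dderiv_met p v w e l m : ccod a p ->
  @dderiv R (E * E * E)%type R^o metf (p, v, w) (e, l, m) =
  @dderiv R E R^o (fun y => met a y v w) p e + met a p l w + met a p v m.
Proof.
move=> ap; apply: dderivE; first exact: (@norm_hausdorff R R^o).
set D := dderiv _ _ _.
have xp : (p + s *: e) @[s --> (0 : R)^'] --> p by exact: line_cvg.
have cm y z : met a (p + s *: e) y z @[s --> (0 : R)^'] --> met a p y z.
  by apply: met_cvg => //; apply: cvg_cst.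
have near_dom : \forall s \near (0 : R)^', ccod a (p + s *: e).
  by apply: xp; apply: open_nbhs_nbhs; split => //; apply: ccod_open.
have -> : D + met a p l w + met a p v m =
   D + met a p l w + met a p v m + 0 * met a p l m by ring.
apply: (@cvg_trans _ (((fun s => @dquot R E R^o (fun y => met a y v w) p e s
   + met a (p + s *: e) l w + met a (p + s *: e) v m
   + s * met a (p + s *: e) l m) : R -> R^o) @ (0 : R)^')); last first.
  apply: cvgD; last by apply: cvgM; [exact: (@nbhs_dnbhs R^o)|exact: cm].
  apply: cvgD; last exact: cm.
  by apply: cvgD; [exact: has_dderiv_met|exact: cm].
apply: near_eq_cvg; near=> s.
have s0 : s != 0 by near: s; exact: nbhs_dnbhs_neq.
have ds : ccod a (p + s *: e) by apply: (near near_dom s).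
rewrite /dquot /metf /= !(metDl _ _ _ ds) !(metDr _ _ _ ds) !(metZl _ _ _ ds).
rewrite !(metZr _ _ _ ds).
have sc (x : R) (y : R^o) : x *: y = x * (y : R) by [].
rewrite !sc; field.
Unshelve. all: by end_near. Qed.

Lemma met_curve_derive (x Y Z : R -> E) (t : R) (dx dY dZ : E) :
  ccod a (x t) -> @has_dderiv R R^o E x t 1 dx ->
  @has_dderiv R R^o E Y t 1 dY -> @has_dderiv R R^o E Z t 1 dZ ->
  is_derive t 1 (fun r => met a (x r) (Y r) (Z r))
    (@dderiv R E R^o (fun y => met a y (Y t) (Z t)) (x t) dx
     + met a (x t) dY (Z t) + met a (x t) (Y t) dZ).
Proof.
move=> ax xd Yd Zd; rewrite -dderiv_met //.
apply: (has_dderiv_comp_curve dom metf (fun r => (x r, Y r, Z r))).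
- exact: dom_open.
- exact: met_smooth.
- by [].
- by do 2 (apply: has_dderiv_pair => //).
Qed.

(** Compatibility of the Levi-Civita connection with the metric: in Koszul's
    formula the two derivatives in the directions [w] and [z] cancel. *)
Lemma christoffel_compat x v w z : ccod a x ->
  christoffel a x v w z + christoffel a x v z w =
  @dderiv R E R^o (fun y => met a y w z) x v.
Proof.
move=> ax; rewrite /christoffel.
have sym w' z' e : @dderiv R E R^o (fun y => met a y w' z') x e =
    @dderiv R E R^o (fun y => met a y z' w') x e.
  apply: dderiv_near; have : \forall y \near x, ccod a y.
    by apply: open_nbhs_nbhs; split => //; apply: ccod_open.
  by apply: filterS => y ay; apply: met_sym.
rewrite (sym z w); lra.
Qed.

Lemma parallel_met_derive0 (x Y Z : R -> E) (t : R) (dx dY dZ : E) :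
  ccod a (x t) -> @has_dderiv R R^o E x t 1 dx ->
  @has_dderiv R R^o E Y t 1 dY -> @has_dderiv R R^o E Z t 1 dZ ->
  (forall z, met a (x t) dY z + christoffel a (x t) dx (Y t) z = 0) ->
  (forall z, met a (x t) dZ z + christoffel a (x t) dx (Z t) z = 0) ->
  is_derive t 1 (fun r => met a (x r) (Y r) (Z r)) 0.
Proof.
move=> ax xd Yd Zd Y0 Z0.
apply: is_derive_eq (met_curve_derive ax xd Yd Zd) _.
rewrite -christoffel_compat // (met_sym ax (Y t)).
have := Y0 (Z t); have := Z0 (Y t); lra.
Qed.

End Charts.
End RiemannianMetric.

(** * Parallel transport and geodesics *)

Section ParallelTransport.
Local Set Implicit Arguments.
Local Unset Strict Implicit.
Context {R : realType} {E : tvsType R} {U : topologicalType}.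
Variable M : riemannian E U.

(** The local coordinates of fields may be paired in any chart: this is the
    chart-independence of the metric. *)
Lemma met_lfield (a : atlas M) (c c' : R -> U) (X X' : R -> E) t :
  cdom a (c t) -> c' t = c t ->
  met a (phi a (c t)) (lfield a c X t) (lfield a c' X' t) =
  gmetric M (c t) (X t) (X' t).
Proof.
by move=> ac E0; rewrite /lfield E0; apply: met_compat => //; apply: chart_atP.
Qed.

Lemma near_chart (a : atlas M) (c : R -> U) (t : R) :
  {for t, continuous c} -> cdom a (c t) ->
  \forall r \near t, cdom a (c r).
Proof.
move=> cc ac; apply: cc; apply: open_nbhs_nbhs; split => //.
exact: cdom_open.
Qed.

Lemma parallel_lfield_continuous I (a : atlas M) c X (t : R) :
  @parallel R E U M I c X -> I t -> cdom a (c t) ->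
  {for t, continuous (lfield a c X : R -> E)}.
Proof.
by move=> /(_ a) [/(_ 0%N) [H _] _] It ac; apply: H.
Qed.

Lemma parallel_lfield_derive I (a : atlas M) c X (t : R) :
  @parallel R E U M I c X -> I t -> cdom a (c t) ->
  @has_dderiv R R^o E (lfield a c X) t 1 (@dderiv R R^o E (lfield a c X) t 1).
Proof.
by move=> /(_ a) [/(_ 1%N) [_ [H _]] _] It ac; apply: dderivP; apply: H.
Qed.

Lemma smooth_curve_derive I (a : atlas M) c (t : R) :
  smooth_curve M I c -> I t -> cdom a (c t) ->
  @has_dderiv R R^o E (phi a \o c) t 1 (lvelocity a c t).
Proof.
move=> [_ /(_ a 1%N) [_ [H _]]] It ac; apply: dderivP; exact: H.
Qed.

Lemma parallel_metric_derive0 I I' (c c' : R -> U) (X X' : R -> E) (t : R) :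
  smooth_curve M I c -> parallel M I c X -> parallel M I' c' X' ->
  I t -> I' t -> (\forall r \near t, c' r = c r) ->
  is_derive t 1 (fun r => gmetric M (c r) (X r) (X' r)) 0.
Proof.
move=> sc pX pX' It I't near_c; have ct := nbhs_singleton near_c.
set a := chart_at M (c t); have ac : cdom a (c t) by exact: chart_atP.
have ac' : cdom a (c' t) by rewrite ct.
apply/has_dderiv_real.
apply: (@has_dderiv_near R R^o R^o
  (fun r => met a (phi a (c r)) (lfield a c X r) (lfield a c' X' r))).
  have near_a := near_chart (sc.1 t It) ac.
  near=> r; apply: met_lfield; first exact: (near near_a r).
  exact: (near near_c r).
apply/has_dderiv_real.
apply: (parallel_met_derive0 (x := phi a \o c)).
- by have [] := phiP ac.
- exact: (smooth_curve_derive sc It ac).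
- exact: (parallel_lfield_derive pX It ac).
- exact: (parallel_lfield_derive pX' I't ac').
- by have [_] := pX a; apply.
- have -> : lvelocity a c t = lvelocity a c' t.
    by apply: dderiv_near; apply: filterS near_c => r /= ->.
  by move=> z; have [_ /(_ t I't ac' z)] := pX' a; rewrite /= ct.
Unshelve. all: by end_near. Qed.

Lemma parallel_metric_continuous I I' (c c' : R -> U) (X X' : R -> E)
    (A : set R) (t : R) :
  smooth_curve M I c -> parallel M I c X -> parallel M I' c' X' ->
  I t -> I' t -> A t -> (forall r, A r -> c' r = c r) ->
  (fun r => gmetric M (c r) (X r) (X' r)) @ within A (nbhs t) -->
    gmetric M (c t) (X t) (X' t).
Proof.
move=> sc pX pX' It I't At cA; have ct := cA t At.
set a := chart_at M (c t); have ac : cdom a (c t) by exact: chart_atP.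
have ac' : cdom a (c' t) by rewrite ct.
rewrite -(met_lfield X X' ac ct).
have near_a := near_chart (sc.1 t It) ac.
apply: (@cvg_trans _ ((fun r => met a (phi a (c r)) (lfield a c X r)
    (lfield a c' X' r)) @ within A (nbhs t))).
  apply: near_eq_cvg; rewrite near_withinE; near=> r => Ar.
  apply: met_lfield; last exact: cA.
  exact: (near near_a r).
apply: cvg_within_filter; apply: met_cvg.
- by have [] := phiP ac.
- apply: (@continuous_comp R U E c (phi a)); first exact: sc.1.
  exact: phi_continuous.
- exact: (parallel_lfield_continuous pX).
- exact: (parallel_lfield_continuous pX').
Unshelve. all: by end_near. Qed.

(** Parallel transport is isometric. The fields are carried by two curves which
    need to agree on [[0, 1]] only, since the curve along which a gradient is
    transported is determined by its endpoints no further than that. Hence the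
    pairing is differentiated in the open interval, where the curves agree
    locally, and only continuity is used at the endpoints. *)
Lemma parallel_isometry (e e' : R) (c c' : R -> U) (X X' : R -> E) (t : R) :
  0 < e -> 0 < e' ->
  smooth_curve M `]- e, 1 + e[ c ->
  parallel M `]- e, 1 + e[ c X -> parallel M `]- e', 1 + e'[ c' X' ->
  (forall r, 0 <= r <= 1 -> c' r = c r) -> 0 <= t <= 1 ->
  gmetric M (c t) (X t) (X' t) = gmetric M (c 0) (X 0) (X' 0).
Proof.
move=> e0 e'0 sc pX pX' cc' /andP[t0 t1].
have dom (d : R) (r : R) : 0 < d -> r \in `[0, t] -> `]- d, 1 + d[%classic r.
  by move=> d0; rewrite in_itv /= in_itv /=; lra.
set G : R -> R := fun r => gmetric M (c r) (X r) (X' r).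
have [r rt||r rt GE] := @MVT_segment R G (cst 0) 0 t t0.
- have rt' : r \in `[0, t] by exact: subset_itv_oo_cc rt.
  apply: (parallel_metric_derive0 sc pX pX'); [exact: dom|exact: dom|].
  have : \forall s \near r, s \in `]0, t[ by exact: near_in_itvoo.
  by apply: filterS => s; rewrite in_itv /= => st; apply: cc'; lra.
- apply: (subspace_continuousP _ _).2 => s /= st.
  apply: (parallel_metric_continuous sc pX pX' (dom _ _ e0 st)
    (dom _ _ e'0 st)) => //.
  by move=> r'; rewrite /= in_itv /= => rt; apply: cc'; lra.
by move: GE; rewrite /cst mul0r => /eqP; rewrite subr_eq0 => /eqP.
Qed.

(** The velocity of a geodesic is parallel along it. *)
Lemma geodesic_speed (c : R -> U) (t : R) : geodesic01 M c -> 0 <= t <= 1 ->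
  tnorm M (c t) (velocity M c t) = tnorm M (c 0) (velocity M c 0).
Proof.
move=> [e [e0 sc pv]] t01; congr Num.sqrt.
exact: (parallel_isometry e0 e0 sc pv pv).
Qed.

Lemma geodesic_length (c : R -> U) (s : R) : geodesic01 M c -> 0 <= s <= 1 ->
  curve_length M c s 1 = (tnorm M (c 0) (velocity M c 0) * (1 - s))%:E.
Proof.
move=> gc /andP[s0 s1]; rewrite /curve_length.
under eq_integral => t.
  rewrite inE /= in_itv /= => /andP[st t1].
  rewrite (geodesic_speed gc (t := t)); last by rewrite t1 (le_trans s0).
over.
rewrite integral_cst //=.
rewrite lebesgue_measure_itv /= lte_fin.
have [_|s1'] := ltP s 1; first by rewrite EFinM EFinB.
have -> : s = 1 by apply/le_anti; rewrite s1.
by rewrite subrr mulr0 mule0.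
Qed.

Lemma gdist_ge0 u q : (0 <= gdist M u q)%E.
Proof.
apply: le_ereal_inf_tmp => _ [a [b [c [_ _ _ ->]]]].
by apply: integral_ge0 => t _; rewrite lee_fin tnorm_ge0.
Qed.

Lemma Cn_subset k (V W : tvsType R) (O O' : set V) (f : V -> W) :
  O' `<=` O -> Cn k O f -> Cn k O' f.
Proof.
elim: k V W O O' f => [|k IH] V W O O' f OO' /= [cf df].
  by split=> // x /OO'; apply: cf.
split=> [x /OO'|]; first exact: cf.
split=> [x /OO'|]; first exact: df.1.
by apply: IH df.2 => -[x v] [/OO' Ox _].
Qed.

Lemma smooth_curve_subset (I I' : set R) (c : R -> U) :
  I' `<=` I -> smooth_curve M I c -> smooth_curve M I' c.
Proof.
move=> II' [cc sc]; split=> [r /II'|a k]; first exact: cc.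
by apply: Cn_subset (sc a k); apply: setSI.
Qed.

Lemma geodesic_gdist_tail (c : R -> U) (t : R) : geodesic01 M c -> 0 <= t < 1 ->
  (gdist M (c t) (c 1%R) <= curve_length M c t 1%R)%E.
Proof.
move=> [e [e0 sc _]] /andP[t0 t1]; apply: ereal_inf_lbound.

exists t, 1%R, c; split => //.
exists 1%N, (fun i => if i == 0%N then t else 1%R); split => //.
move=> [|//] _; split => //=; exists e, c; split => //.
apply: smooth_curve_subset sc => r /=; rewrite !in_itv /=; lra.
Qed.

Lemma min_geodesic_speed u q c : min_geodesic M u q c ->
  gdist M u q = (tnorm M (c 0) (velocity M c 0))%:E.
Proof.
by move=> [gc _ _ <-]; rewrite geodesic_length // ?subr0 ?mulr1 // lexx ler01.
Qed.

(** The points of a minimizing geodesic stay within the distance of its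
    endpoints, so that the Lipschitz condition applies to each of them. *)
Lemma min_geodesic_gdist_tail u q c (t : R) : min_geodesic M u q c ->
  0 <= t < 1 -> (gdist M (c t) q <= gdist M u q)%E.
Proof.
move=> mc t01; rewrite (min_geodesic_speed mc); have [gc _ c1 _] := mc.
rewrite -c1; apply: le_trans (geodesic_gdist_tail gc t01) _.
have /andP[t0 t1] := t01.
rewrite geodesic_length //; last by rewrite t0 ltW.
by rewrite lee_fin ler_piMr ?tnorm_ge0 //; lra.
Qed.

(** * Functions with Lipschitz gradient *)

(** The metric part of [lipschitz_C1], with its constant exposed. *)
Definition lipschitz_C1_with (f : U -> R) (L : R) : Prop :=
  forall u q, (gdist M u q < inj_radius M)%E ->
    exists c : R -> U, [/\ min_geodesic M u q c,
      forall c', min_geodesic M u q c' -> forall t, 0 <= t <= 1 -> c' t = c t &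
      exists2 v, parallel_back M c (grad M f q) v &
        ((tnorm M u (v - grad M f u))%:E <= L%:E * gdist M u q)%E].

(** All gradients of a family can be transported at once: each function comes
    with its own minimizing geodesic, but these agree on [[0, 1]], so that the
    transported gradients keep the Gram matrix of the original ones. *)
Lemma lipschitz_family_transport {T : Type} (f : T -> U -> R) (L : T -> R) u q :
  (forall i, lipschitz_C1_with (f i) (L i)) ->
  (gdist M u q < inj_radius M)%E ->
  exists V : T -> E,
    [/\ forall i, ((tnorm M u (V i - grad M (f i) u))%:E
                    <= (L i)%:E * gdist M u q)%E &
      forall i k, gmetric M u (V i) (V k) =
                  gmetric M q (grad M (f i) q) (grad M (f k) q)].
Proof.
move=> fL uq.
have /choice[c cP] i := fL i u q uq.
have /choice[V VP] i : exists v, parallel_back M (c i) (grad M (f i) q) v /\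
    ((tnorm M u (v - grad M (f i) u))%:E <= (L i)%:E * gdist M u q)%E.
  by have [_ _ [v ? ?]] := cP i; exists v.
exists V; split=> [i|i k]; first by have [] := VP i.
have [[e [X [e0 pX X1 X0]]] _] := VP i.
have [[e' [X' [e'0 pX' X'1 X'0]]] _] := VP k.
have [[gi ci0 ci1 _] ci_unique _] := cP i.
have [mk _ _] := cP k.
have cik := ci_unique _ mk.
have [d [d0 sc _]] := gi.
(* the two fields live on different open intervals around [[0, 1]] *)
have pX_I : parallel M `]- Num.min d e, 1 + Num.min d e[ (c i) X.
  move=> a; have [pX1 pX2] := pX a; split=> [m|t].
    apply: Cn_subset (pX1 m); apply: setSI => r /=.
    by rewrite !in_itv /= ltrNl lt_min -ltrBlDl lt_min; lra.
  rewrite /= in_itv /= ltrNl lt_min -ltrBlDl lt_min => t_in.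
  by apply: pX2; rewrite /= in_itv /=; lra.
have sc_I : smooth_curve M `]- Num.min d e, 1 + Num.min d e[ (c i).
  apply: smooth_curve_subset sc => r /=.
  by rewrite !in_itv /= ltrNl lt_min -ltrBlDl lt_min; lra.
have := parallel_isometry (t := 1) _ e'0 sc_I pX_I pX' cik.
rewrite ci0 ci1 X0 X1 X'0 X'1 => -> //.
- by rewrite lt_min d0.
- by rewrite ler01 lexx.
Qed.

Lemma gram_tnorm {T : finType} u q (V W : T -> E) (al : T -> R) :
  (forall i k, gmetric M u (V i) (V k) = gmetric M q (W i) (W k)) ->
  tnorm M u (\sum_i al i *: V i) = tnorm M q (\sum_i al i *: W i).
Proof.
move=> VW; congr Num.sqrt.
have expand (p : U) (Z : T -> E) :
    gmetric M p (\sum_i al i *: Z i) (\sum_i al i *: Z i) =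
    \sum_i \sum_k al i * (al k * gmetric M p (Z i) (Z k)).
  rewrite (ip_suml _ (gmetric_linear M p)); apply: eq_bigr => i _.
  rewrite (ipZl _ (gmetric_linear M p)) gmetric_sym.
  rewrite (ip_suml _ (gmetric_linear M p)) mulr_sumr; apply: eq_bigr => k _.
  by rewrite (ipZl _ (gmetric_linear M p)) gmetric_sym.
by rewrite !expand; do 2 (apply: eq_bigr => ? _); rewrite VW.
Qed.

Lemma C1_curve_derive (f : U -> R) I c (t : R) : C1_function M f ->
  (exists g, is_gradient M f (c t) g) -> smooth_curve M I c -> I t ->
  is_derive t 1 (f \o c)
    (gmetric M (c t) (grad M f (c t)) (velocity M c t)).
Proof.
move=> Cf gf sc It; set a := chart_at M (c t).
have ac : cdom a (c t) by exact: chart_atP.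
have gradf : is_gradient M f (c t) (grad M f (c t)) by exact: gradP.
have fv : @has_dderiv R E R^o (f \o psi a) (phi a (c t)) (velocity M c t)
    (gmetric M (c t) (grad M f (c t)) (velocity M c t)) by exact: gradf.
rewrite -(dderivE _ _ _ _ (@norm_hausdorff R R^o) fv).
apply/has_dderiv_real.
apply: (@has_dderiv_near R R^o R^o ((f \o psi a) \o (phi a \o c))).
  apply: filterS (near_chart (sc.1 t It) ac) => r /= acr.
  by have [_ ->] := phiP acr.
apply/has_dderiv_real.
apply: (has_dderiv_comp_curve (ccod a) (f \o psi a) (phi a \o c)).
- exact: ccod_open.
- exact: Cf.
- by have [] := phiP ac.
- exact: smooth_curve_derive sc It ac.
Qed.

(** The mean value theorem along the minimizing geodesic [c], of constant speed
    [gdist M u q]; transport from [q] bounds the gradient at [c t]. The manifold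
    topology cannot be used instead, because for a weak metric convergence in
    [gdist] need not imply convergence in it. *)
Lemma lipschitz_increment (f : U -> R) (L : R) u q :
  C1_function M f -> (forall p, exists g, is_gradient M f p g) ->
  0 < L -> lipschitz_C1_with f L -> (gdist M u q < inj_radius M)%E ->
  `|f u - f q| <=
    (tnorm M q (grad M f q) + L * fine (gdist M u q)) * fine (gdist M u q).
Proof.
move=> Cf gf L0 fL uq; have [c [mc _ _]] := fL u q uq.
have speed := min_geodesic_speed mc.
have [gc c0 c1 _] := mc; have [e [e0 sc _]] := gc.
set D := fine (gdist M u q).
have DE : D = tnorm M (c 0) (velocity M c 0) by rewrite /D speed.
have dE : gdist M u q = D%:E by rewrite DE.
have D0 : 0 <= D by rewrite DE tnorm_ge0.
pose df (t : R) := gmetric M (c t) (grad M f (c t)) (velocity M c t).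
have dfP (t : R) : 0 <= t <= 1 -> is_derive t 1 (f \o c) (df t).
  move=> t01; apply: (C1_curve_derive Cf (gf _) sc).
  by rewrite /= in_itv /=; lra.
have [t|t t01|t t01 /= E0] := @MVT R (f \o c) df 0 1 ltr01.
- by rewrite in_itv /= => t01; apply: dfP; lra.
- apply: derivable_within_continuous => r; rewrite in_itv /= => r01.
  by have [] := dfP r r01.
move: t01; rewrite in_itv /= => /andP[t0 t1].
rewrite c0 c1 subr0 mulr1 in E0.
rewrite distrC E0 (le_trans (gmetric_cauchy_schwarz _ _ _ _)) //.
rewrite (geodesic_speed gc) ?(ltW t0) ?(ltW t1) // -DE ler_wpM2r //.
have tq : (gdist M (c t) q <= gdist M u q)%E.
  by apply: min_geodesic_gdist_tail mc _; rewrite t1 ltW.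
have [V [VL VG]] := @lipschitz_family_transport unit (fun=> f) (fun=> L) (c t) q
  (fun=> fL) (le_lt_trans tq uq).
have VN : tnorm M (c t) (V tt) = tnorm M q (grad M f q).
  by congr Num.sqrt; apply: VG.
have -> : grad M f (c t) = V tt + (-1) *: (V tt - grad M f (c t)).
  by rewrite scaleN1r opprB addrC subrK.
apply: le_trans (tnormD _ _ _ _) _; rewrite tnormZ normrN1 mul1r VN lerD2l.
rewrite -lee_fin (le_trans (VL tt)) // EFinM -dE lee_pmul2l //.
Qed.

End ParallelTransport.

(** * Projection onto the constraint cone *)

Section ConeProjection.
Local Set Implicit Arguments.
Local Unset Strict Implicit.
Context {R : realType} {n : nat}.
Implicit Types (y z p : 'rV[R]_n) (C : set 'rV[R]_n).

Lemma dot_linear (k : R) v w z : dot (k *: v + w) z = k * dot v z + dot w z.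
Proof.
rewrite /dot mulr_sumr -big_split; apply: eq_bigr => i _.
by rewrite !mxE mulrDl mulrA.
Qed.

Lemma dotC y z : dot y z = dot z y.
Proof. by apply: eq_bigr => i _; rewrite mulrC. Qed.

Lemma dot_gt0 y : y != 0 -> 0 < dot y y.
Proof.
move=> y0; have sq i : 0 <= y 0 i * y 0 i by rewrite -expr2 sqr_ge0.
rewrite lt_def sumr_ge0 // andbT; apply: contraNN y0.
rewrite psumr_eq0 // => /allP y0; apply/eqP/rowP => i; rewrite mxE.
by have := y0 i (mem_index_enum _); rewrite /= mulf_eq0 orbb => /eqP.
Qed.

Lemma enorm_ge0 y : 0 <= enorm y. Proof. exact: sqrtr_ge0. Qed.

Lemma enormD y z : enorm (y + z) <= enorm y + enorm z.
Proof. exact: (ipnormD _ dot_linear dotC dot_gt0). Qed.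

Lemma enormZ (k : R) y : enorm (k *: y) = `|k| * enorm y.
Proof. exact: (ipnormZ _ dot_linear dotC). Qed.

Lemma enorm_coord y i : `|y 0 i| <= enorm y.
Proof.
rewrite -sqrtr_sqr ler_wsqrtr // /dot (bigD1 i) //= expr2 lerDl.
by apply: sumr_ge0 => k _; rewrite -expr2 sqr_ge0.
Qed.

Lemma enorm_sqr y : enorm y ^+ 2 = \sum_i y 0 i ^+ 2.
Proof.
rewrite sqr_sqrtr; first by apply: eq_bigr => i _; rewrite expr2.
by apply: sumr_ge0 => k _; rewrite -expr2 sqr_ge0.
Qed.

(** When the angle at [p] is obtuse, [p] is strictly closer to [y] than any
    other point of [C], by the law of cosines. *)
Section Variational.
Variables (C : set 'rV[R]_n) (y p : 'rV[R]_n).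
Hypothesis Cp : C p.
Hypothesis obtuse : forall z, C z -> 0 <= dot (y - p) (p - z).

Let pythagoras z : C z ->
  dot (y - p) (y - p) + dot (p - z) (p - z) <= dot (y - z) (y - z).
Proof.
move=> /obtuse; have -> : y - z = (y - p) + (p - z) by rewrite addrA subrK.
move: (y - p) (p - z) => a b ab0.
rewrite !(ipDl _ dot_linear, ipDr _ dot_linear dotC) (dotC b a); lra.
Qed.

Let dot_ge0 z : 0 <= dot z z. Proof. exact: (ip_ge0 _ dot_linear dot_gt0). Qed.

Lemma eproj_variational : eproj C y = p.
Proof.
apply: xget_unique => /=.
  split=> // z Cz; apply: ler_wsqrtr.
  by apply: le_trans (pythagoras Cz); rewrite lerDl dot_ge0.
move=> z [Cz /(_ p Cp)]; rewrite ler_sqrt // => yz.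
apply/esym/eqP; rewrite -subr_eq0; apply/negPn/negP => /dot_gt0.
have := pythagoras Cz; lra.
Qed.

Lemma edist_variational : Defs.edist C y = enorm (y - p).
Proof.
have lb r : ((fun z => enorm (y - z)) @` C) r -> enorm (y - p) <= r.
  move=> [z Cz <-]; apply: ler_wsqrtr.
  by apply: le_trans (pythagoras Cz); rewrite lerDl dot_ge0.
apply/le_anti/andP; split.
  by apply: ge_inf; [exists (enorm (y - p))|exists p].
by apply: lb_le_inf => //; exists (enorm (y - p)), p.
Qed.

End Variational.

(** Coordinate of [y - eproj K y], i.e. of the projection onto the polar cone,
    which up to the factor [mu] is the updated multiplier. *)
Definition multiplier_part (b : bool) (x : R) : R :=
  if b then x else Num.max 0 x.

Variable Eq : {set 'I_n}.
Let K := @coneK R n Eq.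

Definition proj_coneK y : 'rV[R]_n :=
  \row_i (y 0 i - multiplier_part (i \in Eq) (y 0 i)).

Lemma proj_coneK_in y : K (proj_coneK y).
Proof.
split=> i iE; rewrite !mxE /multiplier_part.
  by rewrite iE subrr.
by rewrite (negbTE iE) subr_le0 le_max lexx orbT.
Qed.

Lemma proj_coneK_obtuse y z : K z ->
  0 <= dot (y - proj_coneK y) (proj_coneK y - z).
Proof.
move=> [zE zI]; apply: sumr_ge0 => i _; rewrite !mxE opprB addrC subrK.
rewrite /multiplier_part; case: ifPn => iE.
  by rewrite zE // subrr !subr0 mulr0.
have := zI i iE; rewrite /Num.max; case: ltP => // y0 z0; last by rewrite mul0r.
by rewrite subrr sub0r mulr_ge0 // ?oppr_ge0 // ltW.
Qed.

Lemma eproj_coneK y : eproj K y = proj_coneK y.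
Proof. exact: eproj_variational (proj_coneK_in y) (@proj_coneK_obtuse y). Qed.

Lemma sub_eproj_coneK y i :
  (y - eproj K y) 0 i = multiplier_part (i \in Eq) (y 0 i).
Proof. by rewrite eproj_coneK !mxE opprB addrC subrK. Qed.

Lemma edist_coneK_sqr y :
  Defs.edist K y ^+ 2 = \sum_i multiplier_part (i \in Eq) (y 0 i) ^+ 2.
Proof.
rewrite (edist_variational (proj_coneK_in y) (@proj_coneK_obtuse y)) enorm_sqr.
by apply: eq_bigr => i _; rewrite -eproj_coneK sub_eproj_coneK.
Qed.

Lemma eproj_oppK y i :
  (eproj [set - z | z in (K : set _)] y) 0 i =
  if i \in Eq then 0 else Num.max 0 (y 0 i).
Proof.
rewrite (@eproj_variational _ _ (- proj_coneK (- y))).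
- rewrite !mxE /multiplier_part; case: ifP => _; first by rewrite subrr oppr0.
  rewrite /Num.max; case: ltP => y1; case: ltP => y2; rewrite ?subrr; lra.
- by exists (proj_coneK (- y)) => //; apply: proj_coneK_in.
- move=> _ [z Kz <-]; have := proj_coneK_obtuse (- y) Kz.
  set p := proj_coneK _.
  have -> : - y - p = (-1) *: (y - - p) by rewrite scaleN1r opprK opprD.
  have -> : p - z = (-1) *: (- p - - z) by rewrite scaleN1r opprB opprK addrC.
  rewrite (ipZl _ dot_linear) (ipZr _ dot_linear dotC); lra.
Qed.

(** The squared distance to the cone is differentiable although the
    projection in general is not: the kink of [Num.max 0] disappears on
    squaring, with this uniform quadratic error. *)
Lemma multiplier_part_taylor b (x k : R) :
  `|multiplier_part b (x + k) ^+ 2 - multiplier_part b x ^+ 2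
    - k * (2 * multiplier_part b x)| <= k ^+ 2.
Proof.
rewrite /multiplier_part; case: b.
  have -> : (x + k) ^+ 2 - x ^+ 2 - k * (2 * x) = k ^+ 2 by ring.
  by rewrite ger0_norm ?sqr_ge0.
rewrite ler_norml /Num.max.
by case: ltP => a; case: ltP => c; apply/andP; split; nra.
Qed.

End ConeProjection.

(** * Gradient of the augmented Lagrangian *)

Section AugmentedLagrangian.
Local Set Implicit Arguments.
Local Unset Strict Implicit.
Context {R : realType}.

Lemma is_derive_quadratic_error (f : R -> R) (x d : R) :
  (forall k, `|f (x + k) - f x - k * d| <= k ^+ 2) -> is_derive x 1 f d.
Proof.
move=> fd; apply/has_dderiv_real; rewrite /has_dderiv.
apply/cvgrPdist_le => e e0; near=> k.
have k0 : k != 0 by near: k; exact: nbhs_dnbhs_neq.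
have ke : `|k| < e by near: k; apply: dnbhs0_lt.
rewrite /dquot [k *: 1]mulr1 -(ler_pM2l (x := `|k|)) ?normr_gt0 //.
rewrite -normrM mulrBr [k * (_ *: _)]mulrA divff // mul1r distrC.
rewrite (le_trans (fd k)) // -normr_id -[k ^+ 2]ger0_norm ?sqr_ge0 // normrX.
by rewrite expr2 normr_id ler_wpM2l // ltW.
Unshelve. all: by end_near. Qed.

Context {E : tvsType R} {U : topologicalType}.
Variable M : riemannian E U.

Lemma is_gradient_line (f : U -> R) u g :
  is_gradient M f u g <-> forall w, is_derive (0 : R) 1
    (fun s : R => f (psi (chart_at M u) (phi (chart_at M u) u + s *: w)))
    (gmetric M u g w).
Proof.
set a := chart_at M u; set x := phi a u.
have line w l : @has_dderiv R E R^o (f \o psi a) x w l <->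
    is_derive (0 : R) 1 (fun s : R => f (psi a (x + s *: w))) l.
  have := has_dderiv_line (f \o psi a) x w 0 l.
  by rewrite scale0r addr0.
by split=> fg w; apply/line; apply: fg.
Qed.

Lemma aug_lagr_is_gradient (n : nat) (f : U -> R) (h : U -> 'rV[R]_n)
    (Eq : {set 'I_n}) (lam : 'rV[R]_n) (mu : R) (u : U) (gf : E)
    (gh : 'I_n -> E) :
  is_gradient M f u gf -> (forall i, is_gradient M (constr h i) u (gh i)) ->
  is_gradient M (aug_lagr h Eq f lam mu) u
    (gf + \sum_i (mu * multiplier_part (i \in Eq)
                         ((h u + mu^-1 *: lam) 0 i)) *: gh i).
Proof.
move=> /is_gradient_line ff hh; apply/is_gradient_line => w.
set a := chart_at M u; set x := phi a u.
have psix : psi a (x + 0 *: w) = u.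
  by rewrite scale0r addr0; have [] := phiP (chart_atP M u).
pose H i (s : R) := h (psi a (x + s *: w)) 0 i + mu^-1 * lam 0 i.
have dH i : is_derive (0 : R) 1 (H i) (gmetric M u (gh i) w).
  have /is_gradient_line /(_ w) dh := hh i.
  apply: is_derive_eq (is_deriveD dh (is_derive_cst (mu^-1 * lam 0 i) _ _)) _.
  by rewrite addr0.
have dQ i : is_derive (0 : R) 1
   (fun s => multiplier_part (i \in Eq) (H i s) ^+ 2)
   (2 * multiplier_part (i \in Eq) (H i 0) * gmetric M u (gh i) w).
  apply: (@is_derive1_comp R (fun y => multiplier_part (i \in Eq) y ^+ 2)).
  by apply: is_derive_quadratic_error => k; apply: multiplier_part_taylor.
have dS := is_derive_sum dQ.
have := is_deriveB (is_deriveD (ff w) (is_deriveZ (mu / 2) dS))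
  (is_derive_cst (enorm lam ^+ 2 / (2 * mu)) _ _).
set F := (X in is_derive _ _ X _) => dF.
have <- : F = (fun s : R => aug_lagr h Eq f lam mu (psi a (x + s *: w))).
  apply/funext => s; rewrite /aug_lagr edist_coneK_sqr /F.
  rewrite /= !fctE /= fct_sumE; congr (_ + _ * _ - _).
  by apply: eq_bigr => i _; rewrite !mxE.
apply: is_derive_eq dF _.
rewrite subr0 (ipDl _ (gmetric_linear M u)) (ip_suml _ (gmetric_linear M u)).
congr (_ + _); rewrite [_ *: _]mulr_sumr; apply: eq_bigr => i _.
by rewrite (ipZl _ (gmetric_linear M u)) /H psix !mxE; field.
Qed.

End AugmentedLagrangian.

(** * Multiplier and penalty updates *)

(** A purely Euclidean section: [hs k] stands for the constraint values at the
    [k]th iterate, and [viol k] is the quantity that decides about the penalty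
    after iteration [k]. *)
Section PenaltyMethod.
Local Set Implicit Arguments.
Local Unset Strict Implicit.
Context {R : realType} {n : nat} (Eq : {set 'I_n}).
Variables (gam tau mu1 b : R) (hs ws lams : nat -> 'rV[R]_n) (mus : nat -> R).
Let K := @coneK R n Eq.
Let shifted k : 'rV[R]_n := hs k.+1 + (mus k)^-1 *: ws k.
Let viol k : R := enorm (hs k.+1 - eproj K (shifted k)).
Hypotheses (gam_gt1 : 1 < gam) (tau01 : 0 < tau < 1) (mu1_gt0 : 0 < mu1).
Hypothesis ws_bounded : forall k, (0 < k)%N -> enorm (ws k) <= b.
Hypothesis mus1 : mus 1%N = mu1.
Hypothesis lams_rec : forall k, (0 < k)%N ->
  lams k.+1 = mus k *: (shifted k - eproj K (shifted k)).
Hypothesis mus_rec : forall k, (0 < k)%N ->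
  mus k.+1 = if (k == 1%N) || (viol k <= tau * viol k.-1) then mus k
             else gam * mus k.

Lemma mus_gt0 k : (0 < k)%N -> 0 < mus k.
Proof.
case: k => // k _; elim: k => [|k IH]; first by rewrite mus1.
rewrite mus_rec //; case: ifP => // _; rewrite mulr_gt0 //.
exact: lt_trans gam_gt1.
Qed.

Lemma mus_le k l : (0 < k)%N -> (k <= l)%N -> mus k <= mus l.
Proof.
move=> k0 /subnK <-; elim: (l - k)%N => //= i IH.
rewrite addSn (le_trans IH) // mus_rec ?addn_gt0 ?k0 ?orbT //.
by case: ifP => // _; rewrite ler_peMl ?ltW ?mus_gt0 ?addn_gt0 ?k0 ?orbT.
Qed.

Lemma mus_unbounded : (~ exists C : R, forall k, (0 < k)%N -> `|mus k| <= C) ->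
  mus k @[k --> \oo] --> +oo.
Proof.
move=> unb; apply/cvgryPge => A.
have [k k0 Ak] : exists2 k, (0 < k)%N & A < mus k.
  apply: contrapT => /forall2NP H; apply: unb; exists A => k k0.
  rewrite (ger0_norm (ltW (mus_gt0 k0))).
  by have [/(_ k0)//|/negP] := H k; rewrite -leNgt.
exists k => // l /= kl; exact: le_trans (ltW Ak) (mus_le k0 kl).
Qed.

Lemma lams_coord k i : (0 < k)%N ->
  lams k.+1 0 i = mus k * multiplier_part (i \in Eq) (shifted k 0 i).
Proof. by move=> k0; rewrite lams_rec // mxE sub_eproj_coneK. Qed.

Lemma lams_ge0 k i : (1 < k)%N -> i \notin Eq -> 0 <= lams k 0 i.
Proof.
case: k => [|k] // k0 iE; rewrite lams_coord // pmulr_rge0 ?mus_gt0 //.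
by rewrite /multiplier_part (negbTE iE) le_max lexx.
Qed.

Section Bounded.
Hypothesis mus_bounded : exists C : R, forall k, (0 < k)%N -> `|mus k| <= C.

(** An increase multiplies the penalty by [gam], so none can occur once the
    penalty exceeds its supremum divided by [gam]. *)
Lemma viol_eventually_contracts :
  exists2 k0, (0 < k0)%N & forall k, (k0 <= k)%N -> viol k.+1 <= tau * viol k.
Proof.
have [C muC] := mus_bounded; pose S := [set mus k | k in [set k | (0 < k)%N]].
have S0 : S !=set0 by exists (mus 1%N); exists 1%N.
have ubS : has_ubound S.
  by exists C => _ [k k0 <-]; apply: le_trans (ler_norm _) (muC k k0).
have leS k : (0 < k)%N -> mus k <= sup S.
  by move=> k0; apply: ub_le_sup => //; exists k.
have supS0 : 0 < sup S := lt_le_trans (mus_gt0 (ltn0Sn 0)) (leS 1%N (ltn0Sn 0)).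
have gam0 : 0 < gam := lt_trans ltr01 gam_gt1.
have [_ [k0 k00 <-] k0S] : exists2 x, S x & sup S / gam < x.
  by apply: sup_gt => //; rewrite ltr_pdivrMr // ltr_pMr.
exists k0 => // k kk0; have k_gt0 : (0 < k)%N := leq_trans k00 kk0.
have := leS k.+2 (ltn0Sn _); rewrite mus_rec //.
case: ifP => [/orP[/eqP[k1]|//]|_].
  by rewrite k1 in k_gt0.
have : sup S / gam < mus k.+1 by apply: lt_le_trans k0S (mus_le k00 (leqW kk0)).
by rewrite ltr_pdivrMr // mulrC leNgt => ->.
Qed.

Lemma viol_cvg0 : viol k @[k --> \oo] --> (0 : R).
Proof.
have [k0 _ contr] := viol_eventually_contracts.
have /andP[tau0 tau1] := tau01.
have geometric_bound i : viol (i + k0)%N <= tau ^+ i * viol k0.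
  elim: i => [|i IH]; first by rewrite expr0 mul1r.
  apply: le_trans (contr (i + k0)%N (leq_addl _ _)) _.
  by rewrite exprS -mulrA ler_pM2l.
rewrite -(cvg_shiftn k0).
apply: (@squeeze_cvgr _ _ _ _ (cst 0) (fun i => tau ^+ i * viol k0)).
- by apply: nearW => i; rewrite enorm_ge0; apply: geometric_bound.
- exact: cvg_cst.
- rewrite -[X in _ --> X](mul0r (viol k0)); apply: cvgM; last exact: cvg_cst.
  by apply: cvg_expr; rewrite (ger0_norm (ltW tau0)).
Qed.

(** The new multiplier is [mu (h - pi_K) + w], and [h - pi_K] is controlled by
    [viol]. *)
Lemma lams_bounded : exists C : R, forall k, (0 < k)%N -> enorm (lams k) <= C.
Proof.
have [C muC] := mus_bounded.
have /cvg_seq_bounded [D [_ /(_ (D + 1))]] : cvgn viol by apply: cvgP viol_cvg0.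
rewrite ltrDl ltr01 => /(_ isT) violD.
exists (Num.max (enorm (lams 1%N)) (C * (D + 1) + b)) => -[|[|k]] // _.
  by rewrite le_max lexx.
rewrite le_max lams_rec //; apply/orP; right.
have mu0 := mus_gt0 (ltn0Sn k).
have -> : mus k.+1 *: (shifted k.+1 - eproj K (shifted k.+1)) =
    mus k.+1 *: (hs k.+2 - eproj K (shifted k.+1)) + ws k.+1.
  by rewrite {1}/shifted addrAC scalerDr scalerA mulfV ?gt_eqF // scale1r.
apply: le_trans (enormD _ _) (lerD _ (ws_bounded _)) => //.
rewrite enormZ ler_pM ?enorm_ge0 //; first exact: muC.
exact: le_trans (ler_norm _) (violD k.+1 I).
Qed.

End Bounded.

Let sub_coord (x y : 'rV[R]_n) i : (x - y) 0 i = x 0 i - y 0 i.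
Proof. by rewrite !mxE. Qed.

Lemma constr_eq_le_viol k i : i \in Eq -> `|hs k.+1 0 i| <= viol k.
Proof.
move=> iE; have := enorm_coord (hs k.+1 - eproj K (shifted k)) i.
have [PE _] := proj_coneK_in Eq (shifted k).
by rewrite -/(viol k) sub_coord eproj_coneK PE // subr0.
Qed.

Lemma constr_ineq_le_viol k i : i \notin Eq -> hs k.+1 0 i <= viol k.
Proof.
move=> iE; have := enorm_coord (hs k.+1 - eproj K (shifted k)) i.
have [_ PI] := proj_coneK_in Eq (shifted k).
rewrite -/(viol k) sub_coord eproj_coneK => /(le_trans (ler_norm _)).
apply: le_trans; rewrite lerDl oppr_ge0; exact: PI.
Qed.

(** A nonzero multiplier means that the projection lands on the face where
    coordinate [i] vanishes, and then [viol k] bounds [hs k.+1 0 i] itself. *)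
Lemma complementarity_le_viol k i : (0 < k)%N -> i \notin Eq ->
  `|lams k.+1 0 i * hs k.+1 0 i| <= `|lams k.+1 0 i| * viol k.
Proof.
move=> k0 iE; rewrite normrM.
have := enorm_coord (hs k.+1 - eproj K (shifted k)) i.
rewrite -/(viol k) sub_coord eproj_coneK.
rewrite lams_coord // [proj_coneK _ _ _ _]mxE /multiplier_part (negbTE iE).
have [s0|s0] := leP (shifted k 0 i) 0; first by rewrite mulr0 normr0 !mul0r.
by rewrite subrr subr0; apply: ler_wpM2l.
Qed.

(** With [y := - mu h], the product times [mu] is [y (w - y)] when both
    factors are positive, i.e. when [0 < y < w]; so a large penalty makes the
    product small whatever the size of the multiplier. *)
Lemma complementarity_le_mu k i : (0 < k)%N -> i \notin Eq ->
  0 <= Num.max 0 (- hs k.+1 0 i) * lams k.+1 0 i <= b ^+ 2 / mus k.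
Proof.
move=> k0 iE; have mu0 := mus_gt0 k0.
have b0 : 0 <= b := le_trans (enorm_ge0 _) (ws_bounded k0).
have wb : `|ws k 0 i| <= b := le_trans (enorm_coord _ _) (ws_bounded k0).
have -> : 0 <= Num.max 0 (- hs k.+1 0 i) * lams k.+1 0 i.
  by rewrite mulr_ge0 ?lams_ge0 // le_max lexx.
rewrite /=.
have bmu : 0 <= b ^+ 2 / mus k by rewrite divr_ge0 ?sqr_ge0 ?(ltW mu0).
have [h0|h0] := leP (- hs k.+1 0 i) 0; first by rewrite mul0r.
rewrite lams_coord // /multiplier_part (negbTE iE).
have [s0|s0] := leP (shifted k 0 i) 0; first by rewrite !mulr0.
move: s0; rewrite /shifted !mxE.
set x := hs _ _ _ in h0 *; set w := ws k 0 i in wb *.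
move=> s0; rewrite mulrDr mulrA mulfV ?gt_eqF // mul1r.
rewrite ler_pdivlMr //.
have mx : - mus k * x < w.
  move: s0; rewrite -(pmulr_rgt0 _ mu0) mulrDr mulrA mulfV ?gt_eqF // mul1r.
  lra.
have wb' : w <= b := le_trans (ler_norm _) wb.
have w0 : 0 < w by apply: le_lt_trans mx; rewrite mulNr -mulrN mulr_ge0 // ltW.
set y := - mus k * x in mx.
have -> : - x * (mus k * x + w) * mus k = y * (w - y) by rewrite /y; ring.
have y0 : 0 < y by rewrite /y mulNr -mulrN mulr_gt0.
nra.
Qed.

End PenaltyMethod.

(** * Passing to the limit in the stationarity condition *)

Section LimitPoints.
Local Set Implicit Arguments.
Local Unset Strict Implicit.
Context {R : realType} {E : tvsType R} {U : topologicalType}.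
Variables (M : riemannian E U) (n : nat) (j : U -> R) (h : U -> 'rV[R]_n).
Hypothesis inj_gt0 : (0 < inj_radius M)%E.
Hypothesis j_lip : lipschitz_C1 M j.
Hypothesis j_grad : forall u, exists g, is_gradient M j u g.
Hypothesis h_lip : forall i, lipschitz_C1 M (constr h i).
Hypothesis h_grad : forall i u, exists g, is_gradient M (constr h i) u g.

(** The objective and the constraints as a single family, so that all their
    gradients are transported together. *)
Definition lagr_fun (o : 'I_n.+1) : U -> R := oapp (constr h) j (unlift ord0 o).

Definition lagr_coef (lam : 'rV[R]_n) (o : 'I_n.+1) : R :=
  oapp (lam 0) 1 (unlift ord0 o).

Lemma lagr_gradE u lam : lagr_grad M j h u lam =
  \sum_o lagr_coef lam o *: grad M (lagr_fun o) u.
Proof.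
rewrite big_ord_recl /lagr_coef /lagr_fun unlift_none /= scale1r; congr (_ + _).
by apply: eq_bigr => i _; rewrite liftK.
Qed.

(** The stationarity residual at [q] is the norm, at [u], of the transported
    combination, since transport preserves the Gram matrix; each transported
    gradient is then compared with the gradient at [u]. *)
Lemma lagr_grad_transport : exists2 L : 'I_n.+1 -> R, forall o, 0 < L o &
  forall u q lam, (gdist M u q < inj_radius M)%E ->
    tnorm M q (lagr_grad M j h q lam) <= tnorm M u (lagr_grad M j h u lam)
      + (\sum_o `|lagr_coef lam o| * L o) * fine (gdist M u q).
Proof.
have /choice[L LP] o : exists L, 0 < L /\ lipschitz_C1_with M (lagr_fun o) L.
  rewrite /lagr_fun; case: unliftP => [i _|_] /=.
    by have [_ [L L0 HL]] := h_lip i; exists L.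
  by have [_ [L L0 HL]] := j_lip; exists L.
exists L; [move=> o|move=> u q lam uq]; first by have [] := LP o.
have [V [VL VG]] := lipschitz_family_transport (fun o => (LP o).2) uq.
have dE : gdist M u q = (fine (gdist M u q))%:E.
  rewrite fineK // ge0_fin_numE ?gdist_ge0 //; exact: lt_le_trans uq (leey _).
rewrite !lagr_gradE -(gram_tnorm _ VG).
have -> : \sum_o lagr_coef lam o *: V o =
    \sum_o lagr_coef lam o *: grad M (lagr_fun o) u
    + \sum_o lagr_coef lam o *: (V o - grad M (lagr_fun o) u).
  rewrite -big_split; apply: eq_bigr => o _.
  by rewrite /= -scalerDr addrC subrK.
apply: le_trans (tnormD _ _ _ _) _; rewrite lerD2l.
apply: le_trans (tnorm_sum _ _ _ _) _; rewrite mulr_suml; apply: ler_sum => o _.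
rewrite tnormZ -mulrA ler_wpM2l // -lee_fin EFinM -dE; exact: VL.
Qed.

Lemma lagr_grad_multiplier u lam lam' :
  tnorm M u (lagr_grad M j h u lam) <= tnorm M u (lagr_grad M j h u lam')
    + (\sum_i tnorm M u (grad M (constr h i) u)) * enorm (lam' - lam).
Proof.
have -> : lagr_grad M j h u lam = lagr_grad M j h u lam'
    + \sum_i (lam - lam') 0 i *: grad M (constr h i) u.
  rewrite /lagr_grad -addrA -big_split; congr (_ + _); apply: eq_bigr => i _ /=.
  by rewrite -scalerDl; congr (_ *: _); rewrite !mxE; ring.
apply: le_trans (tnormD _ _ _ _) _; rewrite lerD2l.
apply: le_trans (tnorm_sum _ _ _ _) _; rewrite mulr_suml; apply: ler_sum => i _.
rewrite tnormZ mulrC ler_wpM2l ?tnorm_ge0 //.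
by apply: le_trans (enorm_coord _ i); rewrite !mxE distrC.
Qed.

Lemma cvg_fine_gdist (us : nat -> U) q :
  gdist M (us k) q @[k --> \oo] --> 0%E ->
  fine (gdist M (us k) q) @[k --> \oo] --> (0 : R).
Proof. exact: fine_cvg. Qed.

Lemma near_inj_radius (us : nat -> U) q :
  gdist M (us k) q @[k --> \oo] --> 0%E ->
  \forall k \near \oo, (gdist M (us k) q < inj_radius M)%E.
Proof.
move=> usq; apply: (usq [set x | (x < inj_radius M)%E]).
by apply: open_nbhs_nbhs; split; first exact: open_ereal_lt_ereal.
Qed.

Lemma lipschitz_C1_cvg (f : U -> R) (us : nat -> U) q :
  lipschitz_C1 M f -> (forall u, exists g, is_gradient M f u g) ->
  gdist M (us k) q @[k --> \oo] --> 0%E -> f (us k) @[k --> \oo] --> f q.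
Proof.
move=> [Cf [L L0 fL]] gf usq; have dus := cvg_fine_gdist usq.
apply/subr_cvg0; apply/norm_cvg0P.
pose G := tnorm M q (grad M f q).
apply: (@squeeze_cvgr _ _ _ _ (cst 0)
  (fun k => (G + L * fine (gdist M (us k) q)) * fine (gdist M (us k) q))).
- apply: filterS (near_inj_radius usq) => k uq; rewrite normr_ge0 /=.
  exact: lipschitz_increment Cf gf L0 fL uq.
- by apply: cvg_cst.
- have -> : 0 = (G + L * 0) * 0 :> R by rewrite mulr0.
  apply: cvgM => //; apply: cvgD; first exact: cvg_cst.
  by apply: cvgM => //; apply: cvg_cst.
Qed.

Lemma cvg_sum_ord (I : Type) (r : seq I) (f : I -> nat -> R) (l : I -> R) :
  (forall i, f i k @[k --> \oo] --> l i) ->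
  \sum_(i <- r) f i k @[k --> \oo] --> \sum_(i <- r) l i.
Proof.
move=> fl; elim: r => [|i r IH].
  by rewrite big_nil; under eq_fun do rewrite big_nil; apply: cvg_cst.
by rewrite big_cons; under eq_fun do rewrite big_cons; apply: cvgD.
Qed.

Lemma enorm_cvg_coord (lams : nat -> 'rV[R]_n) lam i :
  enorm (lams k - lam) @[k --> \oo] --> (0 : R) ->
  lams k 0 i @[k --> \oo] --> lam 0 i.
Proof.
move=> lamsl; apply/subr_cvg0; apply/norm_cvg0P.
apply: (@squeeze_cvgr _ _ _ _ (cst 0) (fun k => enorm (lams k - lam))) => //.
  apply: nearW => k; rewrite normr_ge0 /=.
  by apply: le_trans (enorm_coord _ i); rewrite !mxE.
exact: cvg_cst.
Qed.

Lemma stationary_limit (us : nat -> U) (lams : nat -> 'rV[R]_n) q lam :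
  gdist M (us k) q @[k --> \oo] --> 0%E ->
  enorm (lams k - lam) @[k --> \oo] --> (0 : R) ->
  tnorm M (us k) (lagr_grad M j h (us k) (lams k)) @[k --> \oo] --> (0 : R) ->
  lagr_grad M j h q lam = 0.
Proof.
move=> usq lamsl stat; have [L L0 trans] := lagr_grad_transport.
apply: (@tnorm_eq0 _ _ _ M q); apply/le_anti; rewrite tnorm_ge0 andbT.
pose G := \sum_i tnorm M q (grad M (constr h i) q).
pose coefs (l : 'rV[R]_n) := \sum_o `|lagr_coef l o| * L o.
have ccoefs : coefs (lams k) @[k --> \oo] --> coefs lam.
  apply: cvg_sum_ord => o; apply: cvgM; last exact: cvg_cst.
  apply: cvg_norm; rewrite /lagr_coef; case: unliftP => [i _|_] /=.
    exact: enorm_cvg_coord.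
  exact: cvg_cst.
apply: (@ler_cvg_to _ \oo _ _ (cst (tnorm M q (lagr_grad M j h q lam)))
  (fun k => tnorm M (us k) (lagr_grad M j h (us k) (lams k))
    + coefs (lams k) * fine (gdist M (us k) q)
    + G * enorm (lams k - lam)) (tnorm M q (lagr_grad M j h q lam)) 0).
- by apply: cvg_cst.
- have -> : 0 = 0 + coefs lam * 0 + G * 0 :> R by rewrite !mulr0 !addr0.
  apply: cvgD; last by apply: cvgM => //; apply: cvg_cst.
  by apply: cvgD => //; apply: cvgM => //; exact: cvg_fine_gdist.
- apply: filterS (near_inj_radius usq) => k uq.
  apply: le_trans (lagr_grad_multiplier _ _ (lams k)) _.
  by rewrite lerD2r; exact: trans.
Qed.

End LimitPoints.

(** * Limit points of one run *)

(** A multiplier with index [k] results from iteration [k.-1], so the estimates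
    of a subsequence [s] are read along its predecessors. *)
Lemma subsequence_pred_cvg (s : nat -> nat) :
  {homo s : i i' / (i < i')%N} -> (s i).-1 @[i --> \oo] --> \oo.
Proof.
move=> s_incr; have s_ge i : (i <= s i)%N.
  by elim: i => // i /leq_ltn_trans; apply; apply: s_incr.
apply/cvgnyPge => A; exists A.+1 => // i /= Ai.
by rewrite -ltnS; apply: leq_trans (leq_trans Ai (s_ge i)) (leqSpred _).
Qed.

Section OneRun.
Local Set Implicit Arguments.
Local Unset Strict Implicit.
Context {R : realType} {E : tvsType R} {U : topologicalType}.
Variables (M : riemannian E U) (n : nat) (j : U -> R) (h : U -> 'rV[R]_n).
Variable Eq : {set 'I_n}.
Hypothesis inj_gt0 : (0 < inj_radius M)%E.
Hypothesis j_lip : lipschitz_C1 M j.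
Hypothesis j_grad : forall u, exists g, is_gradient M j u g.
Hypothesis h_lip : forall i, lipschitz_C1 M (constr h i).
Hypothesis h_grad : forall i u, exists g, is_gradient M (constr h i) u g.
Variables (gam tau mu1 b : R) (us : nat -> U).
Variables (ws lams : nat -> 'rV[R]_n) (mus : nat -> R).
Let K := @coneK R n Eq.
Let shifted k : 'rV[R]_n := h (us k.+1) + (mus k)^-1 *: ws k.
Let viol k : R := enorm (h (us k.+1) - eproj K (shifted k)).
Hypotheses (gam_gt1 : 1 < gam) (tau01 : 0 < tau < 1) (mu1_gt0 : 0 < mu1).
Hypothesis ws_bounded : forall k, (0 < k)%N -> enorm (ws k) <= b.
Hypothesis mus1 : mus 1%N = mu1.
Hypothesis lams_rec : forall k, (0 < k)%N ->
  lams k.+1 = mus k *: (shifted k - eproj K (shifted k)).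
Hypothesis mus_rec : forall k, (0 < k)%N ->
  mus k.+1 = if (k == 1%N) || (viol k <= tau * viol k.-1) then mus k
             else gam * mus k.
Hypothesis grad_to0 : tnorm M (us k.+1)
  (grad M (aug_lagr h Eq j (ws k) (mus k)) (us k.+1)) @[k --> \oo] --> (0 : R).

(** The multiplier update is chosen so that the gradient of the augmented
    Lagrangian at [ws k] is that of the Lagrangian at the new multiplier. *)
Lemma grad_aug_lagr k : (0 < k)%N ->
  grad M (aug_lagr h Eq j (ws k) (mus k)) (us k.+1) =
  lagr_grad M j h (us k.+1) (lams k.+1).
Proof.
move=> k0; apply: gradE.
have gj : is_gradient M j (us k.+1) (grad M j (us k.+1)) by exact: gradP.
have gh i : is_gradient M (constr h i) (us k.+1)
    (grad M (constr h i) (us k.+1)) by exact: gradP.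
have := aug_lagr_is_gradient (Eq := Eq) (lam := ws k) (mu := mus k) gj gh.
congr (is_gradient _ _ _ (_ + _)); apply: eq_bigr => i _.
by rewrite (lams_coord (hs := h \o us) lams_rec).
Qed.

Lemma lagr_grad_cvg0 (r : nat -> nat) : r @ \oo --> \oo ->
  tnorm M (us (r i).+1) (lagr_grad M j h (us (r i).+1) (lams (r i).+1))
    @[i --> \oo] --> (0 : R).
Proof.
move=> roo; apply: (@cvg_comp _ _ _ r (fun k => tnorm M (us k.+1)
  (lagr_grad M j h (us k.+1) (lams k.+1))) _ _ _ roo).
apply: cvg_trans grad_to0; apply: near_eq_cvg.
by exists 1%N => // k /= k0; rewrite grad_aug_lagr.
Qed.

Lemma bounded_penalty_KKT uhat lamhat :
  (exists C : R, forall k, (0 < k)%N -> `|mus k| <= C) ->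
  gdist_limit_point2 M us lams uhat lamhat -> KKT_point M j h Eq uhat lamhat.
Proof.
move=> mus_bounded [s [s_incr usl lamsl]].
set r := fun i => (s i).-1.
have roo : r @ \oo --> \oo := subsequence_pred_cvg s s_incr.
have r_gt0 : \forall i \near \oo, (0 < r i)%N.
  by apply: (roo [set k | (0 < k)%N]); exists 1%N.
have sr : \forall i \near \oo, s i = (r i).+1.
  by apply: filterS r_gt0 => i; rewrite /r; case: (s i).
have usl' : gdist M (us (r i).+1) uhat @[i --> \oo] --> 0%E.
  by apply: cvg_trans usl; apply: near_eq_cvg; apply: filterS sr => i ->.
have lamsl' : enorm (lams (r i).+1 - lamhat) @[i --> \oo] --> (0 : R).
  by apply: cvg_trans lamsl; apply: near_eq_cvg; apply: filterS sr => i ->.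
have viol0 : viol (r i) @[i --> \oo] --> (0 : R).
  apply: (@cvg_comp _ _ _ r viol _ _ _ roo).
  exact: (viol_cvg0 (hs := h \o us) gam_gt1 tau01 mu1_gt0 mus1 mus_rec
    mus_bounded).
have hl i : h (us (r k).+1) 0 i @[k --> \oo] --> h uhat 0 i.
  exact: (lipschitz_C1_cvg inj_gt0 (h_lip i) (h_grad i) usl').
have laml i : lams (r k).+1 0 i @[k --> \oo] --> lamhat 0 i.
  by apply: enorm_cvg_coord lamsl'.
have h_le0 i : i \notin Eq -> h uhat 0 i <= 0.
  move=> iE; apply: (ler_cvg_to (hl i) viol0); apply: nearW => k.
  exact: (@constr_ineq_le_viol _ _ Eq (h \o us) ws mus).
split.
- by apply: stationary_limit usl' lamsl' (lagr_grad_cvg0 roo).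
- move=> i iE; apply: (cvg_unique _ (hl i)); first exact: norm_hausdorff.
  apply/norm_cvg0P; apply: (@squeeze_cvgr _ _ _ _ (cst 0) (viol \o r)) => //.
    apply: nearW => k; rewrite normr_ge0 /=.
    exact: (@constr_eq_le_viol _ _ Eq (h \o us) ws mus).
  exact: cvg_cst.
move=> i iE; split; first exact: h_le0.
- apply: (ler_cvg_to _ (laml i)); first exact: (cvg_cst 0).
  apply: filterS r_gt0 => k rk.
  by apply: (lams_ge0 (hs := h \o us) gam_gt1 mu1_gt0 mus1 lams_rec mus_rec).
- apply: (cvg_unique _ (cvgM (laml i) (hl i))); first exact: norm_hausdorff.
  apply/norm_cvg0P.
  apply: (@squeeze_cvgr _ _ _ _ (cst 0)
    (fun k => `|lams (r k).+1 0 i| * viol (r k))).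
  + apply: filterS r_gt0 => k rk; rewrite normr_ge0 /=.
    exact: (complementarity_le_viol (hs := h \o us) lams_rec).
  + exact: cvg_cst.
  + rewrite -[X in _ --> X](mulr0 `|lamhat 0 i|).
    by apply: cvgM => //; apply: cvg_norm.
Qed.

Lemma unbounded_penalty_AKKT uhat :
  ~ (exists C : R, forall k, (0 < k)%N -> `|mus k| <= C) ->
  gdist_limit_point M us uhat -> feasible h Eq uhat -> AKKT_point M j h Eq uhat.
Proof.
move=> mus_unb [s [s_incr usl]] feas; split => //.
have muoo := mus_unbounded (hs := h \o us) gam_gt1 mu1_gt0 mus1 mus_rec mus_unb.
(* [AKKT_point] asks for sign conditions at every index, whereas the first
   multiplier is arbitrary: the first two terms are dropped. *)
pose s2 i := s i.+2.
have s2_incr : {homo s2 : i i' / (i < i')%N}.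
  by move=> i i' ii'; apply: s_incr.
pose r i := (s2 i).-1.
have roo : r @ \oo --> \oo := subsequence_pred_cvg s2 s2_incr.
have s_gt1 i : (1 < s2 i)%N.
  have si := leq_ltn_trans (leq0n _) (s_incr i i.+1 (ltnSn _)).
  exact: leq_ltn_trans si (s_incr i.+1 i.+2 (ltnSn _)).
have s2r i : s2 i = (r i).+1 by rewrite /r; case: (s2 i) (s_gt1 i).
have r_gt0 i : (0 < r i)%N by rewrite -ltnS -s2r.
exists (fun i => us (r i).+1), (fun i => lams (r i).+1); split.
- have : gdist M (us (s2 i)) uhat @[i --> \oo] --> 0%E.
    by have := usl; rewrite -(cvg_shiftn 2); under eq_fun do rewrite addn2.
  by apply: cvg_trans; apply: near_eq_cvg; apply: nearW => i; rewrite s2r.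
- move=> i _ [c [cE cI] <-]; apply: sumr_ge0 => k _; rewrite mxE.
  have [kE|kE] := boolP (k \in Eq); first by rewrite cE // oppr0 mulr0.
  rewrite mulr_ge0 ?oppr_ge0 ?cI //; have ri := r_gt0 i.
  by apply: (lams_ge0 (hs := h \o us) gam_gt1 mu1_gt0 mus1 lams_rec mus_rec).
- exact: lagr_grad_cvg0.
apply: (@squeeze_cvgr _ _ _ _ (cst 0)
  (fun i => n%:R * (b ^+ 2 * (mus (r i))^-1))).
- apply: nearW => i.
  have term k : 0 <= (eproj [set - y | y in K] (- h (us (r i).+1))) 0 k
      * lams (r i).+1 0 k <= b ^+ 2 / mus (r i).
    rewrite eproj_oppK; case: ifPn => kE.
      rewrite mul0r lexx divr_ge0 ?sqr_ge0 // ltW //.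
      exact: (mus_gt0 (hs := h \o us) gam_gt1 mu1_gt0 mus1 mus_rec).
    rewrite mxE; have ri := r_gt0 i.
    exact: (complementarity_le_mu (hs := h \o us) gam_gt1 mu1_gt0 ws_bounded
      mus1 lams_rec mus_rec).
  apply/andP; split; first by apply: sumr_ge0 => k _; have /andP[] := term k.
  have -> : n%:R * (b ^+ 2 * (mus (r i))^-1) = \sum_(k < n) b ^+ 2 / mus (r i).
    by rewrite sumr_const card_ord mulr_natl.
  by apply: ler_sum => k _; have /andP[] := term k.
- exact: cvg_cst.
- have -> : 0 = n%:R * (b ^+ 2 * 0) :> R by rewrite !mulr0.
  apply: cvgM; first exact: cvg_cst.
  apply: cvgM; first exact: cvg_cst.
  apply/gtr0_cvgV0; last by apply: (@cvg_comp _ _ _ r mus _ _ _ roo).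
  apply: nearW => i.
  exact: (mus_gt0 (hs := h \o us) gam_gt1 mu1_gt0 mus1 mus_rec).
Qed.

End OneRun.

Theorem theorem2p2
  (R : realType) (E : tvsType R) (U : topologicalType) (M : riemannian E U)
  (d : measure_display) (Om : measurableType d) (P : probability Om R)
  (P_complete : measure_is_complete P)
  (m : nat) (Xi : set (rvec R m)) (xi : Om -> rvec R m)
  (xi_measurable : measurable_fun setT xi) (xi_in : forall w, Xi (xi w))
  (J : U -> rvec R m -> R)
  (J_integrable : forall u, P.-integrable setT (fun w => (J u (xi w))%:E))
  (n : nat) (h : U -> 'rV[R]_n) (Eq : {set 'I_n})
  (gam tau : R) (B : set 'rV[R]_n) (u1 : U) (mu1 : R) (lam1 : 'rV[R]_n)
  (gam_gt1 : 1 < gam) (tau01 : 0 < tau < 1) (B_bounded : ebounded B)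
  (mu1_gt0 : 0 < mu1)
  (ws : nat -> Om -> 'rV[R]_n) (ts : nat -> Om -> R) (Ns ms : nat -> Om -> nat)
  (F : nat -> set (set Om)) (Rs : nat -> Om -> nat)
  (xs : nat -> nat -> nat -> Om -> rvec R m)
  (us : nat -> Om -> U) (lams : nat -> Om -> 'rV[R]_n) (mus : nat -> Om -> R)
  (zs : nat -> nat -> Om -> U)
  (draws : sampling P xi Xi F Ns ms Rs xs)
  (generated : {ae P, forall w,
    run M J h Eq gam tau B u1 mu1 lam1
      (ws ^~ w) (ts ^~ w) (Ns ^~ w) (ms ^~ w) (Rs ^~ w)
      (fun k l s => xs k l s w)
      (us ^~ w) (lams ^~ w) (mus ^~ w) (fun k l => zs k l w)})
  (hypA : geometric_assumption M)
  (hypB : regularity_assumption M P J xi Xi h)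
  (Bhat : set U) (Bhat_bounded : gbounded M Bhat)
  (Bhat_diam : forall u q, Bhat u -> Bhat q -> (gdist M u q <= inj_radius M)%E)
  (us_in : {ae P, forall w, forall k, (0 < k)%N -> Bhat (us k w)})
  (grad_to0 : {ae P, forall w,
    tnorm M (us k.+1 w)
      (grad M (aug_lagr h Eq (exp_cost P J xi) (ws k w) (mus k w)) (us k.+1 w))
      @[k --> \oo] --> (0 : R)}) :
  let j := exp_cost P J xi in
  let Ev := [set w | exists C : R, forall k, (0 < k)%N -> `|mus k w| <= C] in
  {ae P, forall w, Ev w ->
    (exists C : R, forall k, (0 < k)%N -> enorm (lams k w) <= C) /\
    forall (uhat : U) (lamhat : 'rV[R]_n),
      gdist_limit_point2 M (us ^~ w) (lams ^~ w) uhat lamhat ->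
      KKT_point M j h Eq uhat lamhat} /\
  {ae P, forall w, (~` Ev) w ->
    forall uhat : U, gdist_limit_point M (us ^~ w) uhat -> feasible h Eq uhat ->
      AKKT_point M j h Eq uhat}.
Proof.
move=> j Ev.
have [_ inj_gt0 _] := hypA.
have [[j_lip j_grad] h_reg _ _ _] := hypB.
have h_lip i := (h_reg i).1; have h_grad i := (h_reg i).2.
have [b Bb] := B_bounded.
pose viol w k := enorm (h (us k.+1 w) - eproj (@coneK R n Eq)
  (h (us k.+1 w) + (mus k w)^-1 *: ws k w)).
have updates : {ae P, forall w, [/\ mus 1%N w = mu1,
    forall k, (0 < k)%N -> enorm (ws k w) <= b,
    forall k, (0 < k)%N -> lams k.+1 w = mus k w *:
      (h (us k.+1 w) + (mus k w)^-1 *: ws k w - eproj (@coneK R n Eq)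
        (h (us k.+1 w) + (mus k w)^-1 *: ws k w)) &
    forall k, (0 < k)%N -> mus k.+1 w =
      if (k == 1%N) || (viol w k <= tau * viol w k.-1) then mus k w
      else gam * mus k w]}.
  apply: filterS generated => w [_ mus1 _ rec]; split=> // k k0.
  - by have [[Bw _ _ _ _] _ _ _ _] := rec k k0; apply: Bb.
  - by have [_ _ _ ? _] := rec k k0.
  - by case: k k0 => // k k0; have [_ _ _ _ ?] := rec k.+1 k0.
split; apply: filterS2 updates grad_to0
  => w [mus1 ws_b lams_rec mus_rec] gradw muw.
- split.
    exact: (lams_bounded (hs := fun k => h (us k w))
      (ws := ws ^~ w) (lams := lams ^~ w) (mus := mus ^~ w)
      gam_gt1 tau01 mu1_gt0
      ws_b mus1 lams_rec mus_rec muw).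
  move=> uhat lamhat.
  exact: (bounded_penalty_KKT (us := us ^~ w) (ws := ws ^~ w)
    (lams := lams ^~ w) (mus := mus ^~ w)
    inj_gt0 j_lip j_grad h_lip h_grad gam_gt1 tau01
    mu1_gt0 mus1 lams_rec mus_rec gradw muw).
- move=> uhat.
  exact: (unbounded_penalty_AKKT (us := us ^~ w) (ws := ws ^~ w)
    (lams := lams ^~ w) (mus := mus ^~ w)
    j_grad h_grad gam_gt1
    mu1_gt0 ws_b mus1 lams_rec mus_rec gradw muw).
Qed.
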